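(* The cohomology spaces of the spline complex $\mathfrak{S}: 0 \xrightarrow{\mathrm{id}} V_0 \xrightarrow{\mathrm{grad}} V_1 \xrightarrow{\mathrm{curl}} V_2 \xrightarrow{\mathrm{div}} V_3 \xrightarrow{0} 0$ have the following dimensions: $$ \dim \mathcal{H}^0(\mathfrak{S}) = 1, \quad \dim \mathcal{H}^1(\mathfrak{S}) = 1, \quad \dim \mathcal{H}^2(\mathfrak{S}) = 0, \quad \dim \mathcal{H}^3(\mathfrak{S}) = 0. $$
   Context: Setting. Let $\Omega=[0,R]\times[0,S]\times[0,T]$. Let $\mathbb{S}^{p^r}$ be a $C^1$ periodic spline space on $[0,R]$ spanned by $n^r$ (periodic) B-splines $B_i^{p^r}$, $\mathbb{S}^{p^s}$ a $C^1$ spline space on $[0,S]$ (open knot vector) spanned by $n^s$ B-splines $B_j^{p^s}$, and $\mathbb{S}^{p^t}$ a $C^1$ periodic spline space on $[0,T]$ spanned by $n^t$ (periodic) B-splines $B_k^{p^t}$. For a univariate space of degree $p$ on knots $t_1,\dots$, let $D_j^p=\frac{p}{t_{j+p+1}-t_{j+1}}B_{j+1}^{p-1}$ be the functions spanning the derivative space (for the periodic directions these are the $n^r$, resp. $n^t$, functions spanning the $C^0$ periodic derivative space; for the $s$ direction there are $n^s-1$ of them). Tensor-product function sets are vectorized running first over $i$, then $j$, then $k$: $\pmb{B}^{(0,0,0)}=\{B_i^{p^r}B_j^{p^s}B_k^{p^t}\}$, $\pmb{B}^{(1,0,0)}=\{D_i^{p^r}B_j^{p^s}B_k^{p^t}\}$,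 $\pmb{B}^{(0,1,0)}=\{B_i^{p^r}D_j^{p^s}B_k^{p^t}\}_{j\le n^s-1}$, $\pmb{B}^{(0,0,1)}=\{B_i^{p^r}B_j^{p^s}D_k^{p^t}\}$, $\pmb{B}^{(0,1,1)}=\{B_i^{p^r}D_j^{p^s}D_k^{p^t}\}_{j\le n^s-1}$, $\pmb{B}^{(1,0,1)}=\{D_i^{p^r}B_j^{p^s}D_k^{p^t}\}$, $\pmb{B}^{(1,1,0)}=\{D_i^{p^r}D_j^{p^s}B_k^{p^t}\}_{j\le n^s-1}$, $\pmb{B}^{(1,1,1)}=\{D_i^{p^r}D_j^{p^s}D_k^{p^t}\}_{j\le n^s-1}$. Let $\theta_i=2\pi+\frac{(1-2i)\pi}{n^r}$, and let $\bar E$ be the $3\times 2n^r$ matrix with $\bar E_{\ell,(i,1)}=\frac13$ and $(\bar E_{1,(i,2)},\bar E_{2,(i,2)},\bar E_{3,(i,2)})^T=(\frac13,\frac13,\frac13)^T+\begin{pmatrix}\frac13&0\\-\frac16&\frac{\sqrt3}{6}\\-\frac16&-\frac{\sqrt3}{6}\end{pmatrix}(\cos\theta_i,\sin\theta_i)^T$. Let $E^{(0)}=\begin{pmatrix}\bar E&0\\0&I_{n^r(n^s-2)}\end{pmatrix}$. Set $\bar n_0=n^r(n^s-2)+3$, $\bar n_1=2(\bar n_0-2)$, $\bar n_2=\bar n_0-3$. Define $E^{(1,0)}$ ($\bar n_1\times n^rn^s$) by $y=E^{(1,0)}x$: $y_\ell=\sum_{i=1}^{n^r}(\bar E_{\ell+1,(i+1,2)}-\bar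 E_{\ell+1,(i,2)})x_{i+n^r}$ for $\ell=1,2$ (index $n^r+1$ read as $1$), and for $j=3,\dots,n^s$, $i=1,\dots,n^r$: $y_{2+i+(2j-6)n^r}=0$, $y_{2+i+(2j-5)n^r}=x_{i+(j-1)n^r}$. Define $E^{(0,1)}$ ($\bar n_1\times n^r(n^s-1)$) by $y=E^{(0,1)}x$: $y_\ell=\sum_{i=1}^{n^r}(\bar E_{\ell+1,(i,2)}-\bar E_{\ell+1,(i,1)})x_i$ for $\ell=1,2$, and for $j=2,\dots,n^s-1$, $i=1,\dots,n^r$: $y_{2+i+(2j-4)n^r}=x_{i+(j-1)n^r}$, $y_{2+i+(2j-3)n^r}=0$. Let $E^{(2)}$ ($\bar n_2\times n^r(n^s-1)$) be $[0_{\bar n_2\times n^r}\;|\;I_{\bar n_2}]$. Writing $[A;B]$ for stacking rows of $A$ above those of $B$ and $O$ for zero blocks of the appropriate size, define $E^{(0,0,0)}=I_{n^t}\otimes E^{(0)}$; $E^{(1,0,0)}=I_{n^t}\otimes[E^{(1,0)};O]$, $E^{(0,1,0)}=I_{n^t}\otimes[E^{(0,1)};O]$, $E^{(0,0,1)}=I_{n^t}\otimes[O;E^{(0)}]$ (zero blocks with $\bar n_0$, $\bar n_0$, $\bar n_1$ rows respectively); $E^{(0,1,1)}=I_{n^t}\otimes[O;E^{(0,1)}]$, $E^{(1,0,1)}=I_{n^t}\otimes[O;-E^{(1,0)}]$, $E^{(1,1,0)}=I_{n^t}\otimes[E^{(2)};O]$ (zero blocks with $\bar n_2$, $\bar n_2$,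 $\bar n_1$ rows respectively); $E^{(1,1,1)}=I_{n^t}\otimes E^{(2)}$. Then $V_0=\mathrm{span}(E^{(0,0,0)}\pmb{B}^{(0,0,0)})$ (dimension $n^t\bar n_0$); $V_1$ is spanned by the vector functions $(N^{(1,0,0)}_\ell,N^{(0,1,0)}_\ell,N^{(0,0,1)}_\ell)$, $\ell=1,\dots,n^t(\bar n_0+\bar n_1)$, where $\pmb N^{(1,0,0)}=E^{(1,0,0)}\pmb B^{(1,0,0)}$, etc.; $V_2$ is spanned by $(N^{(0,1,1)}_\ell,N^{(1,0,1)}_\ell,N^{(1,1,0)}_\ell)$, $\ell=1,\dots,n^t(\bar n_1+\bar n_2)$, with $\pmb N^{(0,1,1)}=E^{(0,1,1)}\pmb B^{(0,1,1)}$, etc.; $V_3=\mathrm{span}(E^{(1,1,1)}\pmb B^{(1,1,1)})$ (dimension $n^t\bar n_2$). These spaces satisfy $\mathrm{grad}\,V_0\subseteq V_1$, $\mathrm{curl}\,V_1\subseteq V_2$, $\mathrm{div}\,V_2\subseteq V_3$, so $\mathfrak S$ is a complex. *)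

(* Defs.v *)
From HB Require Import structures.
From mathcomp Require Import all_boot all_order all_algebra.
From mathcomp Require Import all_classical all_reals all_analysis.
Set Implicit Arguments. Unset Strict Implicit. Unset Printing Implicit Defensive.
Import Order.TTheory GRing.Theory Num.Theory.
Local Open Scope ring_scope.

Section Splines.
Variable R : realType.

(* ---------- univariate B-splines (Cox--de Boor, convention 0/0 = 0) ------ *)
(* Knots are indexed by int; B_i^p lives on knots tau_i, ..., tau_{i+p+1}.
   (Paper's 1-based t_k is tau_(k-1); paper's B_k is bsp tau p (k-1).) *)
Fixpoint bsp (tau : int -> R) (p : nat) (i : int) (x : R) : R :=
  match p with
  | 0 => if (tau i <= x) && (x < tau (i + 1)) then 1 else 0
  | q.+1 =>
      (x - tau i) / (tau (i + (q.+1)%:Z) - tau i) * bsp tau q i x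
    + (tau (i + (q.+2)%:Z) - x) / (tau (i + (q.+2)%:Z) - tau (i + 1))
        * bsp tau q (i + 1) x
  end.

(* Open knot vector on [0,L] for n B-splines of degree p (knots tau_0..tau_{n+p}),
   with interior knots of multiplicity <= p-1 (C^1 spline space). *)
Definition open_C1_knots (tau : int -> R) (n p : nat) (L : R) : Prop :=
  (p < n)%N /\
  [/\ (forall k : nat, (k < n + p)%N -> tau k%:Z <= tau (k.+1)%:Z),
      (forall k : nat, (k <= p)%N -> tau k%:Z = 0),
      (forall k : nat, (n <= k <= n + p)%N -> tau k%:Z = L),
      (forall k : nat, (p < k < n)%N -> 0 < tau k%:Z < L) &
      (forall k : nat, (p < k)%N -> (k + p - 1 < n)%N ->
          tau k%:Z < tau (k + p - 1)%:Z)].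

(* Periodic knot sequence on [0,L] with n knots per period, C^1 (every knot of
   multiplicity <= p-1); indexed so that 0 <= tau_0 < L (no loss of generality). *)
Definition periodic_C1_knots (tau : int -> R) (n p : nat) (L : R) : Prop :=
  [/\ (0 < n)%N,
      (forall k : int, tau k <= tau (k + 1)),
      (forall k : int, tau (k + n%:Z) = tau k + L),
      0 <= tau 0 < L &
      (forall k : int, tau k < tau (k + (p - 1)%:Z))].

(* Periodic B-spline of degree q (q <= p) on [0,L]: sum of the shifts
   B_{i + k n}, k in Z; only |k| <= p+3 can be nonzero on (0,L). *)
Definition perB (tau : int -> R) (n p q : nat) (i : int) (x : R) : R :=
  \sum_(k < (2 * (p + 3)).+1) bsp tau q (i + ((k%:Z - (p + 3)%:Z) * n%:Z)) x.

Definition perBs (tau : int -> R) (n p : nat) (i : nat) (x : R) : R :=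
  perB tau n p p i%:Z x.
Definition perDs (tau : int -> R) (n p : nat) (i : nat) (x : R) : R :=
  p%:R / (tau (i + p + 1)%:Z - tau (i + 1)%:Z) * perB tau n p (p - 1) (i + 1)%:Z x.

Definition opBs (tau : int -> R) (p : nat) (j : nat) (x : R) : R :=
  bsp tau p j%:Z x.
Definition opDs (tau : int -> R) (p : nat) (j : nat) (x : R) : R :=
  p%:R / (tau (j + p + 1)%:Z - tau (j + 1)%:Z) * bsp tau (p - 1) (j + 1)%:Z x.

Section ExtMats.
Variables nr ns : nat.

Definition n0bar := (nr * (ns - 2) + 3)%N.
Definition n1bar := (2 * (n0bar - 2))%N.
Definition n2bar := (n0bar - 3)%N.

(* theta_i for 0-based i, i.e. paper's theta_{i+1} *)
Definition theta (i : nat) : R := 2 * pi - (2 * i + 1)%:R * pi / nr%:R.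

(* Ebar l (i, col+1) with 0-based row l, 0-based i, col in {0,1} *)
Definition Ebar (l i col : nat) : R :=
  if col == 0%N then 1 / 3
  else 1 / 3 +
    (if l == 0%N then cos (theta i) / 3
     else if l == 1%N then - cos (theta i) / 6 + Num.sqrt 3 / 6 * sin (theta i)
     else - cos (theta i) / 6 - Num.sqrt 3 / 6 * sin (theta i)).

Definition E0 : 'M[R]_(n0bar, nr * ns) :=
  \matrix_(l, c)
    if (l < 3)%N then (if (c < 2 * nr)%N then Ebar l (c %% nr) (c %/ nr) else 0)
    else (if (2 * nr <= c)%N && (l - 3 == c - 2 * nr)%N then 1 else 0).

Definition E10 : 'M[R]_(n1bar, nr * ns) :=
  \matrix_(l, c)
    if (l < 2)%N then
      (if (nr <= c < 2 * nr)%N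
       then Ebar l.+1 ((c - nr).+1 %% nr) 1 - Ebar l.+1 (c - nr) 1 else 0)
    else
      (if odd ((l - 2) %/ nr) && (val c == (l - 2) %% nr + ((l - 2) %/ nr + 3)./2 * nr)%N
       then 1 else 0).

Definition E01 : 'M[R]_(n1bar, nr * (ns - 1)) :=
  \matrix_(l, c)
    if (l < 2)%N then
      (if (c < nr)%N then Ebar l.+1 c 1 - Ebar l.+1 c 0 else 0)
    else
      (if ~~ odd ((l - 2) %/ nr) && (val c == (l - 2) %% nr + (((l - 2) %/ nr)./2 + 1) * nr)%N
       then 1 else 0).

Definition E2 : 'M[R]_(n2bar, nr * (ns - 1)) :=
  \matrix_(l, c) if (val c == l + nr)%N then 1 else 0.

End ExtMats.

Definition sfun := R -> R -> R -> R.
Definition field (m : nat) := 'I_m -> sfun.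

Definition dr (f : sfun) : sfun := fun r s t => derive1 (fun x => f x s t) r.
Definition ds (f : sfun) : sfun := fun r s t => derive1 (fun x => f r x t) s.
Definition dt (f : sfun) : sfun := fun r s t => derive1 (fun x => f r s x) t.

Definition vec3 (a b c : sfun) : field 3 :=
  fun i => if val i == 0%N then a else if val i == 1%N then b else c.
Definition cmp3 (F : field 3) (k : nat) : sfun := F (inord k).

Definition grad (f : field 1) : field 3 :=
  vec3 (dr (f ord0)) (ds (f ord0)) (dt (f ord0)).
Definition curl (F : field 3) : field 3 :=
  vec3 (fun r s t => ds (cmp3 F 2) r s t - dt (cmp3 F 1) r s t)
       (fun r s t => dt (cmp3 F 0) r s t - dr (cmp3 F 2) r s t)
       (fun r s t => dr (cmp3 F 1) r s t - ds (cmp3 F 0) r s t).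
Definition div (F : field 3) : field 1 :=
  fun _ r s t => dr (cmp3 F 0) r s t + ds (cmp3 F 1) r s t + dt (cmp3 F 2) r s t.

Section Box.
Variables Lr Ls Lt : R.
Definition inbox (r s t : R) : Prop := [/\ 0 < r < Lr, 0 < s < Ls & 0 < t < Lt].

Definition eqbox m (f g : field m) : Prop :=
  forall c r s t, inbox r s t -> f c r s t = g c r s t.
Definition zerof m : field m := fun _ _ _ _ => 0.
Definition subf m (f g : field m) : field m := fun c r s t => f c r s t - g c r s t.
Definition lincomb (I : finType) m (g : I -> field m) (a : I -> R) : field m :=
  fun c r s t => \sum_i a i * g i c r s t.
Definition inspan (I : finType) m (g : I -> field m) (f : field m) : Prop :=
  exists a, eqbox f (lincomb g a).

(* dim (Z / B) = n, for subspaces B <= Z of field m (functions on the box) *)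
Definition qdim m (Z B : field m -> Prop) (n : nat) : Prop :=
  exists e : 'I_n -> field m,
    [/\ forall i, Z (e i),
        forall a : 'I_n -> R, B (lincomb e a) -> forall i, a i = 0 &
        forall z, Z z -> exists a : 'I_n -> R, B (subf z (lincomb e a))].
End Box.

Section Complex.
Variables (Lr Ls Lt : R) (pr ps pt nr ns nt : nat) (tr ts tt : int -> R).

Definition Br i := perBs tr nr pr i.
Definition Dr i := perDs tr nr pr i.
Definition Bs j := opBs ts ps j.
Definition Ds j := opDs ts ps j.
Definition Bt k := perBs tt nt pt k.
Definition Dt k := perDs tt nt pt k.

(* bivariate families, vectorized c = i + j * nr (0-based) *)
Definition B00 (c : 'I_(nr * ns)) (r s : R) := Br (c %% nr) r * Bs (c %/ nr) s.
Definition B10 (c : 'I_(nr * ns)) (r s : R) := Dr (c %% nr) r * Bs (c %/ nr) s.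
Definition B01 (c : 'I_(nr * (ns - 1))) (r s : R) := Br (c %% nr) r * Ds (c %/ nr) s.
Definition B11 (c : 'I_(nr * (ns - 1))) (r s : R) := Dr (c %% nr) r * Ds (c %/ nr) s.

Definition mxfun m n (A : 'M[R]_(m, n)) (f : 'I_n -> R -> R -> R) : 'I_m -> R -> R -> R :=
  fun l r s => \sum_c A l c * f c r s.

(* I_{nt} (x) A acting on blocks: basis functions indexed by (k, l) *)
Definition V0fam (kl : 'I_nt * 'I_(n0bar nr ns)) : field 1 :=
  fun _ r s t => mxfun (E0 nr ns) B00 kl.2 r s * Bt kl.1 t.

Definition V1fam (kl : 'I_nt * 'I_(n1bar nr ns + n0bar nr ns)) : field 3 :=
  vec3 (fun r s t => mxfun (col_mx (E10 nr ns) 0) B10 kl.2 r s * Bt kl.1 t)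
       (fun r s t => mxfun (col_mx (E01 nr ns) 0) B01 kl.2 r s * Bt kl.1 t)
       (fun r s t => mxfun (col_mx 0 (E0 nr ns)) B00 kl.2 r s * Dt kl.1 t).

Definition V2fam (kl : 'I_nt * 'I_(n2bar nr ns + n1bar nr ns)) : field 3 :=
  vec3 (fun r s t => mxfun (col_mx 0 (E01 nr ns)) B01 kl.2 r s * Dt kl.1 t)
       (fun r s t => mxfun (col_mx 0 (- E10 nr ns)) B10 kl.2 r s * Dt kl.1 t)
       (fun r s t => mxfun (col_mx (E2 nr ns) 0) B11 kl.2 r s * Bt kl.1 t).

Definition V3fam (kl : 'I_nt * 'I_(n2bar nr ns)) : field 1 :=
  fun _ r s t => mxfun (E2 nr ns) B11 kl.2 r s * Dt kl.1 t.

Definition inV0 := inspan Lr Ls Lt V0fam.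
Definition inV1 := inspan Lr Ls Lt V1fam.
Definition inV2 := inspan Lr Ls Lt V2fam.
Definition inV3 := inspan Lr Ls Lt V3fam.

Definition Z0 f := inV0 f /\ eqbox Lr Ls Lt (grad f) (@zerof 3).
Definition B0 f := eqbox Lr Ls Lt f (@zerof 1).
Definition Z1 f := inV1 f /\ eqbox Lr Ls Lt (curl f) (@zerof 3).
Definition B1 f := exists h, inV0 h /\ eqbox Lr Ls Lt f (grad h).
Definition Z2 f := inV2 f /\ eqbox Lr Ls Lt (div f) (@zerof 1).
Definition B2 f := exists h, inV1 h /\ eqbox Lr Ls Lt f (curl h).
Definition Z3 f := inV3 f.
Definition B3 f := exists h, inV2 h /\ eqbox Lr Ls Lt f (div h).

Definition dimH0 := qdim Z0 B0.
Definition dimH1 := qdim Z1 B1.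
Definition dimH2 := qdim Z2 B2.
Definition dimH3 := qdim Z3 B3.
End Complex.
End Splines.

(* Main.v *)
Require Import Defs.
From HB Require Import structures.
From mathcomp Require Import all_boot all_order all_algebra.
From mathcomp Require Import all_classical all_reals all_analysis.
From mathcomp Require Import ring lra zify.
Import Order.TTheory GRing.Theory Num.Theory.
Import numFieldNormedType.Exports.
Local Open Scope ring_scope.

(** The complex is the tensor product of a polar spline complex on a disk in [(r, s)] with a
    periodic one in [t]. Every space is described by tensor-product B-spline coefficients, on
    which the differential operators act by finite differences. Given a closed element, summing
    its [s]-coefficients from the polar edge produces a potential with the prescribed
    [s]-derivative; what is left over is supported on splines in [s] vanishing at [s = 0] and
    has zero [s]-derivative, hence vanishes as a function. Thus the linear independence of
    B-splines is never needed.
    In [H^1] there remains a function of [t] alone, [sum_k psi_k D_k], which is the derivative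
    of a periodic spline once a multiple of [1 = sum_k w_k D_k] is subtracted; the field
    [(0, 0, 1)] is not a gradient because splines in [t] take the same value at both ends. *)

(** Integration runs in [s] because the other two directions are periodic, where a difference can be
    inverted only if the coefficients sum to zero. It stays inside the polar spaces because [E10]
    and [E01] share their two slope coefficients: partial sums of the [s]-component, started at 0,
    acquire on the second ring exactly the slopes that [E0] allows, and their cyclic [r]-differences
    agree with the [r]-component on the first ring. Identities hold between functions on the open
    box, so a remainder is shown to vanish as a function while its coefficients stay undetermined.
    The analytic obstacle is smoothness at knots, since [bsp] is built from half-open indicators and
    quotients with 0/0 = 0. The gap between the polynomials on the two sides of a point has a closed
    form, nonzero only when at least degree + 1 knots meet there; this turns the multiplicity bounds
    into continuity and a derivative formula that holds at knots too. *)

Local Open Scope classical_set_scope.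

(** * Calculus *)

Section Calculus.
Variable R : realType.
Implicit Types (f g : R -> R) (x l : R).

Lemma is_derive_continuous f x l : is_derive x 1 f l -> {for x, continuous f}.
Proof.
by case=> df _; apply/differentiable_continuous/derivable1_diffP.
Qed.

Lemma is_derive_mul f g x df dg :
  is_derive x 1 f df -> is_derive x 1 g dg ->
  is_derive x 1 (fun y => f y * g y) (df * g x + f x * dg).
Proof.
move=> hf hg; have H := is_deriveM hf hg.
by apply: (is_derive_eq H); rewrite addrC /GRing.scale /= [g x * df]mulrC.
Qed.

Lemma is_derive_add f g x df dg :
  is_derive x 1 f df -> is_derive x 1 g dg ->
  is_derive x 1 (fun y => f y + g y) (df + dg).
Proof. exact: is_deriveD. Qed.

Lemma is_derive_scale f c x df :
  is_derive x 1 f df -> is_derive x 1 (fun y => c * f y) (c * df).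
Proof. exact: is_deriveZ. Qed.

Lemma is_derive_bigsum n (h : nat -> R -> R) (dh : nat -> R) x :
  (forall i, (i < n)%N -> is_derive x 1 (h i) (dh i)) ->
  is_derive x 1 (fun y => \sum_(i < n) h i y) (\sum_(i < n) dh i).
Proof.
elim: n => [|n IH] H.
  rewrite big_ord0; under eq_fun do rewrite big_ord0.
  exact: is_derive_cst.
rewrite big_ord_recr /=; under eq_fun do rewrite big_ord_recr /=.
by apply: is_derive_add; [apply: IH => i /ltnW; apply: H | apply: H].
Qed.

Lemma continuous_bigsum n (h : nat -> R -> R) x :
  (forall i, (i < n)%N -> {for x, continuous (h i)}) ->
  {for x, continuous (fun y => \sum_(i < n) h i y)}.
Proof.
elim: n => [|n IH] H.
  rewrite (_ : (fun y => _) = cst 0); first exact: cst_continuous.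
  by apply/funext => y; rewrite big_ord0.
rewrite (_ : (fun y => _) = (fun y => \sum_(i < n) h i y) \+ h n).
  by apply: continuousD; [apply: IH => i /ltnW; apply: H | apply: H].
by apply/funext => y; rewrite big_ord_recr.
Qed.

(** Each difference quotient looks at one side only, so agreement of the two pieces to first order
    at [x] suffices. The value at [x] belongs to the right piece, as in the half-open indicators of
    [bsp]. *)
Lemma is_derive_glue f (f1 f2 : R -> R) x l :
  (\forall y \near x, x <= y -> f y = f1 y) ->
  (\forall y \near x, y < x -> f y = f2 y) ->
  f1 x = f2 x -> is_derive x 1 f1 l -> is_derive x 1 f2 l ->
  is_derive x 1 f l.
Proof.
move=> n1 n2 e12 [d1 v1] [d2 v2].
have fx : f x = f1 x by move: (nbhs_singleton n1); apply.
have shift P : (\forall y \near x, P y) -> \forall h \near (0:R)^', P (h + x).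
  move=> nP; apply: cvg_within.
  have : (h + x @[h --> (0:R)] --> (0:R) + x).
    by apply: cvgD; [exact: cvg_id | exact: cvg_cst].
  by rewrite add0r; apply.
suff H : h^-1 *: (f (h *: 1 + x) - f x) @[h --> (0:R)^'] --> l.
  apply: DeriveDef; first by apply/cvg_ex; exists l.
  by rewrite /derive; apply: cvg_lim.
apply/cvgrPdist_lt => e e0.
have c1 : h^-1 *: (f1 (h *: 1 + x) - f1 x) @[h --> (0:R)^'] --> l by rewrite -v1.
have c2 : h^-1 *: (f2 (h *: 1 + x) - f2 x) @[h --> (0:R)^'] --> l by rewrite -v2.
move/cvgrPdist_lt : c1 => /(_ e e0) c1.
move/cvgrPdist_lt : c2 => /(_ e e0) c2.
have m1 := shift _ n1; have m2 := shift _ n2.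
near=> h.
have E1 : x <= h + x -> f (h + x) = f1 (h + x) by near: h.
have E2 : h + x < x -> f (h + x) = f2 (h + x) by near: h.
have E3 : `|l - h^-1 *: (f1 (h *: 1 + x) - f1 x)| < e by near: h.
have E4 : `|l - h^-1 *: (f2 (h *: 1 + x) - f2 x)| < e by near: h.
rewrite /GRing.scale /= mulr1 fx in E3 E4 *.
by have [/E1 ->|/E2 ->] := leP x (h + x); rewrite // e12.
Unshelve. all: by end_near.
Qed.

Lemma continuous_glue f (f1 f2 : R -> R) x :
  (\forall y \near x, x <= y -> f y = f1 y) ->
  (\forall y \near x, y < x -> f y = f2 y) ->
  f1 x = f2 x -> {for x, continuous f1} -> {for x, continuous f2} ->
  {for x, continuous f}.
Proof.
move=> n1 n2 e12 c1 c2.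
have fx : f x = f1 x by move: (nbhs_singleton n1); apply.
apply/cvgrPdist_lt => e e0.
move/cvgrPdist_lt : c1 => /(_ e e0) c1.
move/cvgrPdist_lt : c2 => /(_ e e0) c2.
near=> h.
have E1 : x <= h -> f h = f1 h by near: h.
have E2 : h < x -> f h = f2 h by near: h.
rewrite fx; have [/E1 ->|/E2 ->] := leP x h; first by near: h.
by rewrite e12; near: h.
Unshelve. all: by end_near.
Qed.

End Calculus.

(** * B-splines near a point *)

Section Cox.
Variable R : realType.
Variable tau : int -> R.

(* The Cox--de Boor recursion started from arbitrary constants [chi] instead of indicator
   functions: near a point, on either side of it, a B-spline coincides with such a
   polynomial. *)
Fixpoint cdb (chi : int -> R) (p : nat) (i : int) (x : R) : R :=
  match p with
  | 0 => chi i
  | q.+1 =>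
      (x - tau i) / (tau (i + (q.+1)%:Z) - tau i) * cdb chi q i x
    + (tau (i + (q.+2)%:Z) - x) / (tau (i + (q.+2)%:Z) - tau (i + 1))
        * cdb chi q (i + 1) x
  end.

Lemma shift1S (i : int) (q : nat) : i + 1 + q%:Z = i + (q.+1)%:Z.
Proof. lia. Qed.

Hypothesis tau_mono : forall i j : int, i <= j -> tau i <= tau j.

Lemma cdb_derive (chi : int -> R) p i (x : R) :
  is_derive x 1 (cdb chi p.+1 i)
    (p.+1%:R / (tau (i + p.+1%:Z) - tau i) * cdb chi p i x
     - p.+1%:R / (tau (i + p.+2%:Z) - tau (i + 1)) * cdb chi p (i + 1) x).
Proof.
have lin (a b : R) : is_derive x 1 (fun y => (y - a) / b) b^-1.
  under eq_fun do rewrite mulrC.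
  rewrite -[X in is_derive _ _ _ X]mulr1; apply: is_derive_scale.
  rewrite -[X in is_derive _ _ _ X]addr0.
  exact: is_derive_add.
have nil (a b : R) : is_derive x 1 (fun y => (a - y) / b) (- b^-1).
  under eq_fun do rewrite mulrC.
  rewrite -mulrN1; apply: is_derive_scale; rewrite -[X in is_derive _ _ _ X]add0r.
  exact: is_derive_add.
have step p' i' (a b : R) : is_derive x 1 (cdb chi p' i') a ->
   is_derive x 1 (cdb chi p' (i' + 1)) b ->
   is_derive x 1 (cdb chi p'.+1 i')
     ((tau (i' + p'.+1%:Z) - tau i')^-1 * cdb chi p' i' x
        + (x - tau i') / (tau (i' + p'.+1%:Z) - tau i') * a
     + (- (tau (i' + p'.+2%:Z) - tau (i' + 1))^-1 * cdb chi p' (i' + 1) x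
        + (tau (i' + p'.+2%:Z) - x) / (tau (i' + p'.+2%:Z) - tau (i' + 1)) * b)).
  by move=> ha hb; apply: is_derive_add; apply: is_derive_mul.
elim: p i => [|p IH] i.
  have H := step 0%N i 0 0 (is_derive_cst _ _ _) (is_derive_cst _ _ _).
  by apply: (is_derive_eq H); ring.
pose P := cdb chi p.
have H := step p.+1 i _ _ (IH i) (IH (i + 1)).
apply: (is_derive_eq H) => {H}.
rewrite /= -[i + 1 + 1]/(i + 1 + 1%:Z).
rewrite !shift1S -!/P.
set A := (tau (i + p.+2%:Z) - tau i).
set B := (tau (i + p.+3%:Z) - tau (i + 1)).
set C := (tau (i + p.+2%:Z) - tau (i + 1)).
(* The middle spline [P (i + 1)] occurs with both products, and they differ formally since 0/0 = 0.
   The knot interval of length [C] lies in those of lengths [A] and [B], so [C != 0] forces [A] and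
   [B] nonzero. *)
have key : C^-1 * (B * B^-1) = C^-1 * (A * A^-1).
  have [->|C0] := eqVneq C 0; first by rewrite invr0 !mul0r.
  have h1 : tau i <= tau (i + 1) by apply: tau_mono; lia.
  have h2 : tau (i + 1) <= tau (i + p.+2%:Z) by apply: tau_mono; lia.
  have h3 : tau (i + p.+2%:Z) <= tau (i + p.+3%:Z) by apply: tau_mono; lia.
  have Cp : 0 < C by rewrite lt_def C0 subr_ge0.
  have A0 : A != 0 by rewrite gt_eqF // (lt_le_trans Cp) // /A /C lerD2l lerN2.
  have B0 : B != 0 by rewrite gt_eqF // (lt_le_trans Cp) // /B /C lerD2r.
  by rewrite !divff.
rewrite -[p.+2%:R]natr1 /=.
have : forall a b : R, a - b = 0 -> a = b by move=> a b /subr0_eq.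
apply.
have K : p.+1%:R * P (i + 1) x * (C^-1 * (B * B^-1) - C^-1 * (A * A^-1)) = 0.
  by rewrite key subrr mulr0.
rewrite -[RHS]K /B /A; ring.
Qed.

Section OneSided.
Variable x : R.

(** [chiR] and [chiL] mark the knot interval met just to the right and just to the left of [x];
    freezing the indicators there makes the recursion polynomial. *)
Let chiR (k : int) : R := if (tau k <= x) && (x < tau (k + 1)) then 1 else 0.
Let chiL (k : int) : R := if (tau k < x) && (x <= tau (k + 1)) then 1 else 0.

Lemma bsp_near_right p i :
  \forall y \near x, x <= y -> bsp tau p i y = cdb chiR p i y.
Proof.
elim: p i => [|p IH] i /=; last first.
  have h1 := IH i; have h2 := IH (i + 1).
  near=> y => xy.
  have -> : bsp tau p i y = cdb chiR p i y by move: xy; near: y.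
  by have -> : bsp tau p (i + 1) y = cdb chiR p (i + 1) y by move: xy; near: y.
rewrite /chiR.
have side (a : R) : \forall y \near x, x <= y -> (a <= y) = (a <= x).
  have [ax|xa] := leP a x; first by near=> y => xy; rewrite (le_trans ax).
  have := lt_nbhsl xa; apply: filterS => y ya _; by rewrite leNgt ya.
have h1 := side (tau i); have h2 := side (tau (i + 1)).
near=> y => xy.
have E1 : (tau i <= y) = (tau i <= x) by move: xy; near: y.
have E2 : (tau (i + 1) <= y) = (tau (i + 1) <= x) by move: xy; near: y.
by rewrite E1 !ltNge E2.
Unshelve. all: by end_near.
Qed.

Lemma bsp_near_left p i :
  \forall y \near x, y < x -> bsp tau p i y = cdb chiL p i y.
Proof.
elim: p i => [|p IH] i /=; last first.
  have h1 := IH i; have h2 := IH (i + 1).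
  near=> y => xy.
  have -> : bsp tau p i y = cdb chiL p i y by move: xy; near: y.
  by have -> : bsp tau p (i + 1) y = cdb chiL p (i + 1) y by move: xy; near: y.
rewrite /chiL.
have side (a : R) : \forall y \near x, y < x -> (a <= y) = (a < x).
  have [xa|ax] := leP x a.
    by near=> y => yx; rewrite leNgt (lt_le_trans yx xa).
  have := lt_nbhsr ax; apply: filterS => y ay _; by rewrite ltW.
have h1 := side (tau i); have h2 := side (tau (i + 1)).
near=> y => xy.
have E1 : (tau i <= y) = (tau i < x) by move: xy; near: y.
have E2 : (tau (i + 1) <= y) = (tau (i + 1) < x) by move: xy; near: y.
by rewrite E1 [y < _]ltNge E2 -leNgt.
Unshelve. all: by end_near.
Qed.

(** In each term of the recursion the linear weight is 0 where one indicator holds and 1 where the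
    other does, so one indicator per term survives. The two survivors cancel unless an outer knot
    also lies at [x]. *)
Lemma cdb_jump q i :
  cdb chiR q i x - cdb chiL q i x =
    ([&& tau i == x, tau (i + q%:Z) == x & x < tau (i + q.+1%:Z)])%:R
    - ([&& tau i < x, tau (i + 1) == x & tau (i + q.+1%:Z) == x])%:R.
Proof.
elim: q i => [|q IH] i.
  rewrite /= /chiR /chiL addr0 -[i + 1%:Z]/(i + 1).
  have : tau i <= tau (i + 1) by apply: tau_mono; lia.
  case: (ltgtP (tau i) x); case: (ltgtP (tau (i + 1)) x) => //= *;
    rewrite ?subr0 ?sub0r ?subrr //; exfalso; lra.
rewrite /=.
have -> (a b c d e f : R) : a * b + c * d - (a * e + c * f) = a * (b - e) + c * (d - f) by ring.
rewrite !IH !shift1S.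
have h1 : tau i <= tau (i + 1) by apply: tau_mono; lia.
have h2 : tau (i + 1) <= tau (i + q.+1%:Z) by apply: tau_mono; lia.
have h3 : tau (i + q.+1%:Z) <= tau (i + q.+2%:Z) by apply: tau_mono; lia.
set a := tau i in h1 *; set b := tau (i + 1) in h1 h2 *.
set c := tau (i + q.+1%:Z) in h2 h3 *; set d := tau (i + q.+2%:Z) in h3 *.
have -> : (x - a) / (c - a) *
   ([&& a == x, tau (i + q) == x & x < c]%:R - [&& a < x, b == x & c == x]%:R)
   = - [&& a < x, b == x & c == x]%:R.
  have [->|xa] := eqVneq a x; first by rewrite subrr !mul0r ltxx /= oppr0.
  have [ax|] := boolP [&& a < x, b == x & c == x]; last by rewrite /= subr0 mulr0 oppr0.
  case/and3P: ax => ax _ /eqP cx; rewrite cx divff ?subr_eq0; last by rewrite eq_sym.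
  by rewrite /=; ring.
have -> : (d - x) / (d - b) *
   ([&& b == x, c == x & x < d]%:R - [&& b < x, tau (i + 2%:Z) == x & d == x]%:R)
   = [&& b == x, c == x & x < d]%:R.
  have [->|xd] := eqVneq d x; first by rewrite subrr !mul0r ltxx /= !andbF.
  have [bx|] := boolP [&& b == x, c == x & x < d]; last by rewrite /= !andbF subr0 mulr0.
  case/and3P: bx => /eqP bx _ _; rewrite bx divff ?subr_eq0 //.
  by rewrite /= ltxx /= subr0 mulr1.
case: (ltgtP a x); case: (ltgtP b x); case: (ltgtP c x); case: (ltgtP d x) => //= *;
    rewrite ?subr0 ?sub0r ?subrr ?add0r ?oppr0 ?add0r ?addr0 ?addNr //; exfalso; lra.
Qed.

Lemma cdb_match q i :
  ~~ ((tau i == x) && (tau (i + q%:Z) == x)) ->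
  ~~ ((tau (i + 1) == x) && (tau (i + q.+1%:Z) == x)) ->
  cdb chiR q i x = cdb chiL q i x.
Proof.
move=> h1 h2; apply/eqP; rewrite -subr_eq0 cdb_jump.
by rewrite andbA (negbTE h1) (negbTE h2) andbF subr0.
Qed.

Lemma bsp_continuous p i :
  ~~ ((tau i == x) && (tau (i + p.+1%:Z) == x)) ->
  ~~ ((tau (i + 1) == x) && (tau (i + p.+2%:Z) == x)) ->
  {for x, continuous (bsp tau p.+1 i)}.
Proof.
move=> h1 h2; apply: continuous_glue.
- exact: bsp_near_right.
- exact: bsp_near_left.
- exact: cdb_match.
- exact: is_derive_continuous (cdb_derive _ _ _ _).
- exact: is_derive_continuous (cdb_derive _ _ _ _).
Qed.

(** The three hypotheses exclude [p + 1] coincident knots in the supports of the two splines of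
    degree [p] in the formula, so the one-sided derivatives agree. *)
Lemma bsp_derive p i :
  ~~ ((tau i == x) && (tau (i + p%:Z) == x)) ->
  ~~ ((tau (i + 1) == x) && (tau (i + p.+1%:Z) == x)) ->
  ~~ ((tau (i + 2) == x) && (tau (i + p.+2%:Z) == x)) ->
  is_derive x 1 (bsp tau p.+1 i)
    (p.+1%:R / (tau (i + p.+1%:Z) - tau i) * bsp tau p i x
     - p.+1%:R / (tau (i + p.+2%:Z) - tau (i + 1)) * bsp tau p (i + 1) x).
Proof.
move=> h1 h2 h3.
have R0 k : bsp tau p k x = cdb chiR p k x.
  by have := nbhs_singleton (bsp_near_right p k); apply.
(* A longer run of equal knots contains a shorter one, so the values match wherever the derivatives
   do. *)
have wide (j : int) m : tau j == x -> tau (j + m.+1%:Z) == x -> tau (j + m%:Z) == x.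
  move=> /eqP a /eqP b; rewrite eq_le -{1}b -a !tau_mono //; lia.
rewrite !R0.
apply: is_derive_glue.
- exact: bsp_near_right.
- exact: bsp_near_left.
- apply: cdb_match.
    by apply: contra h1 => /andP[a b]; rewrite a (wide _ _ a b).
  apply: contra h2 => /andP[a]; rewrite -(shift1S i p.+1) => b.
  by rewrite a -(shift1S i p) (wide _ _ a b).
- exact: cdb_derive.
- rewrite (@cdb_match p i) // (@cdb_match p (i + 1)) ?shift1S //; first exact: cdb_derive.
Qed.

End OneSided.

Lemma bsp_out_left q i x : x < tau i -> bsp tau q i x = 0.
Proof.
elim: q i => [|q IH] i xi /=; first by rewrite leNgt xi.
rewrite !IH ?mulr0 ?addr0 //; apply: (lt_le_trans xi); apply: tau_mono; lia.
Qed.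

Lemma bsp_out_right q i x : tau (i + q.+1%:Z) <= x -> bsp tau q i x = 0.
Proof.
elim: q i => [|q IH] i xi /=; first by rewrite ltNge xi andbF.
rewrite !IH ?mulr0 ?addr0 ?shift1S //; apply: le_trans xi; apply: tau_mono; lia.
Qed.

(** After shifting the second half of the recursion by one, every inner spline of degree [q]
    collects two weights of sum 1, while the two boundary splines vanish by their supports. *)
Lemma bsp_sum1 q (a : int) N x :
  tau (a + q%:Z) <= x -> x < tau (a + N%:Z) -> \sum_(m < N) bsp tau q (a + m%:Z) x = 1.
Proof.
elim: q a N => [|q IH] a N.
  rewrite addr0; elim: N => [|N IHN] h1 h2; first by rewrite addr0 ltNge h1 in h2.
  rewrite big_ord_recr /= ; have [h|h] := ltP x (tau (a + N)).
    by rewrite IHN //= addr0.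
  rewrite -addrA (_ : N%:Z + 1 = N.+1%:Z); last by lia.
  rewrite h2 /= big1 ?add0r // => m _.
  rewrite (_ : (x < _) = false) ?andbF //; apply/negbTE; rewrite -leNgt.
  apply: le_trans h; apply: tau_mono; have := ltn_ord m; lia.
move=> h1 h2.
have Npos : (0 < N)%N.
  rewrite lt0n; apply/eqP => N0; move: (le_lt_trans h1 h2); rewrite N0 ltNge tau_mono //; lia.
case: N Npos h2 => // N _ h2 /=.
rewrite big_split /= [X in _ + X](_ : _ = \sum_(m < N.+1) (tau (a + m + q.+2) - x) / (tau (a + m + q.+2) - tau (a + m + 1)) * bsp tau q (a + m.+1%:Z) x); last first.
  by apply: eq_bigr => m _; rewrite -[a + m + 1]addrA (_ : m%:Z + 1 = m.+1%:Z) //; lia.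
rewrite big_ord_recl (@bsp_out_right q (a + 0)) ?addr0 //.
rewrite mulr0 add0r [X in _ + X]big_ord_recr /= (@bsp_out_left q (a + N.+1)) //.
rewrite mulr0 addr0 -big_split /=.
have E : forall m : 'I_N, bsp tau q (a + 1 + m) x = bsp tau q (a + m.+1%:Z) x.
  by move=> m; congr (bsp _ _ _ _); lia.
rewrite -[RHS](IH (a + 1) N) ?shift1S //; apply: eq_bigr => m _.
rewrite E /bump /= (_ : (1 + m)%N = m.+1) //.
have -> : a + m + 1 = a + m.+1 by lia.
have -> : a + m + q.+2 = a + m.+1 + q.+1 by lia.
set i := a + m.+1.
(* On an empty knot span both weights are 0 by the 0/0 convention, but there the spline itself is
   zero. *)
have [h|h] := eqVneq (tau (i + q.+1%:Z)) (tau i).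
  have [xi|xi] := ltP x (tau i); first by rewrite bsp_out_left ?mulr0 ?addr0.
  by rewrite bsp_out_right ?mulr0 ?addr0 // h.
by field; rewrite subr_eq0.
Qed.

End Cox.

Lemma eq_bsp (R : realType) (tau tau' : int -> R) p i x :
  (forall k : int, i <= k <= i + p.+1%:Z -> tau k = tau' k) ->
  bsp tau p i x = bsp tau' p i x.
Proof.
elim: p i => [|p IH] i H /=; first by rewrite !H //; lia.
by rewrite !IH ?H //; try (move=> k hk; apply: H); lia.
Qed.

Lemma bsp_shift (R : realType) (tau : int -> R) n (L : R) p i x :
  (forall k : int, tau (k + n%:Z) = tau k + L) ->
  bsp tau p (i + n%:Z) (x + L) = bsp tau p i x.
Proof.
move=> H; elim: p i => [|p IH] i /=.
  by rewrite [i + n + 1]addrAC !H lerD2r ltrD2r.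
rewrite [i + n + 1]addrAC ![i + n + _%:Z]addrAC !H !IH.
have E (a b : R) : a + L - (b + L) = a - b by ring.
by rewrite !E.
Qed.

(** * Periodic and open spline bases *)

Section Sums.
Variable R : realType.

Lemma sum_prod_nat n m (F : nat -> R) :
  \sum_(c < n * m) F c = \sum_(i < n) \sum_(j < m) F (i + j * n)%N.
Proof.
elim: m => [|m IH].
  by rewrite muln0 big_ord0 big1 // => i _; rewrite big_ord0.
rewrite mulnS addnC big_split_ord /= IH.
under [RHS]eq_bigr do rewrite big_ord_recr /=.
rewrite big_split /=; congr (_ + _); apply: eq_bigr => i _.
by rewrite addnC mulnC.
Qed.

(** Summation by parts: it moves the difference that [perBs_derive] puts on the basis over to the
    coefficients. *)
Lemma sum_cyclic_diff n (c D : nat -> R) :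
  \sum_(i < n) c i * ((if val i is i'.+1 then D i' else D n.-1) - D i) =
  \sum_(i < n) (c (i.+1 %% n)%N - c i) * D i.
Proof.
under eq_bigr do rewrite mulrBr; under [RHS]eq_bigr do rewrite mulrBl.
rewrite !sumrB; congr (_ - _); case: n => [|n]; first by rewrite !big_ord0.
rewrite big_ord_recl [RHS]big_ord_recr /= modnn addrC; congr (_ + _).
by apply: eq_bigr => i _; rewrite modn_small ?ltnS // /bump.
Qed.

Lemma sum_diff n (c D : nat -> R) :
  \sum_(j < n) c j * ((if val j is j'.+1 then D j' else 0)
      - (if (j < n - 1)%N then D j else 0)) =
  \sum_(j < n - 1) (c j.+1 - c j) * D j.
Proof.
under eq_bigr do rewrite mulrBr; under [RHS]eq_bigr do rewrite mulrBl.
rewrite !sumrB; case: n => [|n]; first by rewrite !big_ord0.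
rewrite subn1 /= big_ord_recl [X in _ - X]big_ord_recr /= ltnn !mulr0 add0r addr0.
by congr (_ - _); apply: eq_bigr => i _; rewrite /bump //= ltn_ord.
Qed.

Lemma int_homo (tau : int -> R) :
  (forall k : int, tau k <= tau (k + 1)) -> forall i j : int, i <= j -> tau i <= tau j.
Proof.
move=> H i j ij; have -> : j = i + `|j - i|%N%:Z by lia.
elim: `|_|%N => [|m IH]; first by rewrite addr0.
by apply: (le_trans IH); rewrite -addn1 PoszD addrA.
Qed.

End Sums.

Section Periodic.
Variables (R : realType) (tau : int -> R) (n p : nat) (L : R).
Hypotheses (L0 : 0 < L) (p2 : (2 <= p)%N) (knots : periodic_C1_knots tau n p L).

Let n0 : (0 < n)%N. Proof. by case: knots. Qed.
Let mono : forall i j : int, i <= j -> tau i <= tau j.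
Proof. by case: knots => _ /int_homo. Qed.
Let per (k : int) : tau (k + n%:Z) = tau k + L. Proof. by case: knots. Qed.
Let tau0 : 0 <= tau 0 < L. Proof. by case: knots. Qed.
Let mult (k : int) : tau k < tau (k + (p - 1)%:Z). Proof. by case: knots. Qed.

Let perM m (k : int) : tau (k + m%:Z * n%:Z) = tau k + m%:R * L.
Proof.
elim: m => [|m IH]; first by rewrite !mul0r !addr0.
by rewrite (_ : k + _ = k + m%:Z * n%:Z + n%:Z); [rewrite per IH -natr1; ring | lia].
Qed.

(** Two periods clear the interval. The extreme shifts by [p + 3] periods in [perB] leave that much
    room, because a support spans at most [p + 1] index steps, hence at most [p + 1] periods even
    when [n = 1]. *)
Let neg (k : int) : k <= - 2 * n%:Z -> tau k <= - L.
Proof.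
move=> kn; have : tau k <= tau (- 2 * n%:Z) by apply: mono.
move=> h; apply: (le_trans h); have := perM 2 (- 2 * n%:Z).
rewrite (_ : - 2 * n%:Z + _ = 0); last by lia.
case/andP: tau0; lra.
Qed.

Let big (k : int) : 2 * n%:Z <= k -> L + L <= tau k.
Proof.
move=> kn; have : tau (2 * n%:Z) <= tau k by apply: mono.
apply: le_trans; have := perM 2 0; rewrite add0r => ->; case/andP: tau0; lra.
Qed.

Let below x : x < L -> x < L + L.
Proof. by move=> xL; apply: (lt_trans xL); rewrite ltrDl. Qed.

Let above x : 0 < x -> - L <= x.
Proof. by move=> x0; apply: ltW; apply: lt_trans x0; rewrite oppr_lt0. Qed.

Let simple (j : int) x : ~~ ((tau j == x) && (tau (j + (p - 1)%:Z) == x)).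
Proof. by apply/negP => /andP[/eqP a /eqP b]; have := mult j; rewrite a b ltxx. Qed.

Lemma perB_continuous i x : {for x, continuous (perB tau n p p i)}.
Proof.
have [q pq] : exists q, p = q.+2 by exists (p - 2)%N; lia.
have ne (j : int) : ~~ ((tau j == x) && (tau (j + p%:Z) == x)).
  apply: contra (simple j x) => /andP[/eqP a /eqP b]; rewrite a eqxx /= eq_le.
  by apply/andP; split; [rewrite -b | rewrite -a]; apply: mono; lia.
rewrite /perB.
apply: (@continuous_bigsum _ _ (fun k => bsp tau p (i + (k%:Z - (p + 3)%:Z) * n%:Z))) => k _.
set j := (j in bsp _ _ j); rewrite pq; apply: bsp_continuous => //; rewrite -pq //.
by have := ne (j + 1); rewrite shift1S.
Qed.

(** The two sums match after a shift of [k] by one; the unmatched extreme terms have supports away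
    from the evaluation point. *)
Lemma perB_ends i : (i < n)%N -> perB tau n p p i%:Z 0 = perB tau n p p i%:Z L.
Proof.
move=> ni; rewrite /perB big_ord_recr [RHS]big_ord_recl /=.
rewrite (@bsp_out_left _ _ mono _ _ 0); last first.
  by apply: (@lt_le_trans _ _ (L + L)); [exact: below | apply: big; nia].
rewrite (@bsp_out_right _ _ mono _ _ L); last first.
  by apply: (@le_trans _ _ (- L)); [apply: neg; nia | exact: above].
rewrite addr0 add0r; apply: eq_bigr => k _.
rewrite /bump /= -[in RHS](add0r L) -(bsp_shift _ _ _ _ _ _ 0 per).
congr (bsp _ _ _ _); lia.
Qed.

(** The derivative basis indexed by its first knot, over all integers, so that the predecessor of
    index 0 in [perBs_derive] can be written and then wrapped to [n]. *)
Let perC (j : int) (x : R) := p%:R / (tau (j + p%:Z) - tau j) * perB tau n p (p - 1) j x.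

Let perDsE i x : perDs tau n p i x = perC i.+1%:Z x.
Proof.
rewrite /perDs /perC !addn1 (_ : (i + p).+1%:Z = i.+1%:Z + p%:Z) //; lia.
Qed.

Let perC_wrap x : 0 < x < L -> perC n%:Z x = perC 0 x.
Proof.
move=> /andP[x0 xL]; rewrite /perC.
have -> : n%:Z + p%:Z = p%:Z + n%:Z by lia.
rewrite -[in X in _ - tau X](add0r n%:Z) !per add0r.
rewrite (_ : _ - (_ + L) = tau p%:Z - tau 0); last by ring.
congr (_ * _).
rewrite /perB big_ord_recr [RHS]big_ord_recl /=.
rewrite (@bsp_out_left _ _ mono); last first.
  by apply: (@lt_le_trans _ _ (L + L)); [exact: below | apply: big; nia].
rewrite (@bsp_out_right _ _ mono); last first.
  by apply: (@le_trans _ _ (- L)); [apply: neg; nia | exact: above].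
by rewrite addr0 add0r; apply: eq_bigr => k _; rewrite /bump; congr (bsp _ _ _ _); lia.
Qed.

Lemma perBs_derive i x : (i < n)%N -> 0 < x < L ->
  is_derive x 1 (perBs tau n p i)
    ((if i is i'.+1 then perDs tau n p i' x else perDs tau n p n.-1 x)
     - perDs tau n p i x).
Proof.
move=> ni xL.
have -> : (if i is i'.+1 then perDs tau n p i' x else perDs tau n p n.-1 x) = perC i%:Z x.
  by case: i ni => [|i] ni; rewrite perDsE // prednK // perC_wrap.
rewrite perDsE /perC /perBs /perB !mulr_sumr -sumrB.
have [q pq] : exists q, p = q.+1 by exists (p - 1)%N; lia.
have pq1 : (p - 1)%N = q by lia.
pose idx k : int := i%:Z + (k%:Z - (p + 3)%:Z) * n%:Z.
apply: (@is_derive_bigsum _ _ (fun k y => bsp tau p (idx k) y)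
  (fun k => p%:R / (tau (i%:Z + p%:Z) - tau i%:Z) * bsp tau (p - 1) (idx k) x -
   p%:R / (tau (i.+1%:Z + p%:Z) - tau i.+1%:Z)
     * bsp tau (p - 1) (i.+1%:Z + (k%:Z - (p + 3)%:Z) * n%:Z) x)) => k _.
(* A shift by whole periods moves all knots by the same amount, so knot differences, and hence the
   factors in the derivative, are the same for every term of [perB]. *)
have [c hc] : exists c, forall a, tau (a + (k%:Z - (p + 3)%:Z) * n%:Z) = tau a + c.
  case: (_ - _) => m; first by exists (m%:R * L) => b; rewrite perM.
  exists (- (m.+1%:R * L)) => b; have := perM m.+1 (b + Negz m * n%:Z).
  by rewrite (_ : b + _ + _ = b); [move=> ->; ring | lia].
have -> : tau (i%:Z + p%:Z) - tau i%:Z = tau (idx k + p%:Z) - tau (idx k).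
  by rewrite /idx addrAC !hc; ring.
have -> : tau (i.+1%:Z + p%:Z) - tau i.+1%:Z = tau (idx k + p.+1%:Z) - tau (idx k + 1).
  rewrite (_ : idx k + p.+1%:Z = i.+1%:Z + p%:Z + (k%:Z - (p + 3)%:Z) * n%:Z); last by rewrite /idx; lia.
  rewrite (_ : idx k + 1 = i.+1%:Z + (k%:Z - (p + 3)%:Z) * n%:Z); last by rewrite /idx; lia.
  by rewrite !hc; ring.
rewrite (_ : i.+1%:Z + (k%:Z - (p + 3)%:Z) * n%:Z = idx k + 1); last by rewrite /idx; lia.
rewrite pq1 pq; apply: bsp_derive => //.
- by have := simple (idx k) x; rewrite pq1.
- by have := simple (idx k + 1) x; rewrite pq1 shift1S.
- by have := simple (idx k + 2) x; rewrite pq1 (_ : idx k + 2 + q%:Z = idx k + q.+2%:Z) //; lia.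
Qed.

(** The pairs of a basis index and a period shift enumerate one block of consecutive integers, to
    which [bsp_sum1] applies. The offset [a = 1] serves [perDs]. *)
Let perB_sum q (a : nat) x : (a <= 1)%N -> (q <= p)%N -> 0 < x < L ->
  \sum_(i < n) perB tau n p q (i + a)%N%:Z x = 1.
Proof.
move=> a1 qp /andP[x0 xL]; rewrite /perB.
rewrite -[RHS](@bsp_sum1 _ tau mono q (a%:Z - (p + 3)%:Z * n%:Z) (n * (2 * (p + 3)).+1) x).
- rewrite (@sum_prod_nat _ n (2 * (p + 3)).+1 (fun m => bsp tau q (a%:Z - (p + 3)%:Z * n%:Z + m%:Z) x)).
  by apply: eq_bigr => i _; apply: eq_bigr => k _; congr (bsp _ _ _ _); lia.
- by apply: (@le_trans _ _ (- L)); [apply: neg; nia | exact: above].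
- by apply: (@lt_le_trans _ _ (L + L)); [exact: below | apply: big; nia].
Qed.

Lemma perBs_sum1 x : 0 < x < L -> \sum_(i < n) perBs tau n p i x = 1.
Proof.
move=> xL; rewrite -[RHS](@perB_sum p 0 x) //; apply: eq_bigr => i _.
by rewrite addn0.
Qed.

(** The weights are the inverses of the normalizing factors of [perDs], which leaves the partition
    of unity in degree [p - 1]. Their nonzero sum allows a multiple of 1 to cancel any coefficient
    sum. *)
Lemma perDs_sum1 : exists2 w : nat -> R, \sum_(i < n) w i != 0 &
  forall x, 0 < x < L -> \sum_(i < n) w i * perDs tau n p i x = 1.
Proof.
have gap (i : nat) : 0 < tau (i + p + 1)%N%:Z - tau (i + 1)%N%:Z.
  rewrite subr_gt0; apply: lt_le_trans (mult _) _; apply: mono; lia.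
exists (fun i => (tau (i + p + 1)%N%:Z - tau (i + 1)%N%:Z) / p%:R).
  rewrite gt_eqF // (bigD1 (Ordinal n0)) //=; apply: ltr_pwDl.
    by rewrite divr_gt0 ?ltr0n //; lia.
  by apply: sumr_ge0 => i _; rewrite divr_ge0 ?ler0n // ltW.
move=> x xL; rewrite -[RHS](@perB_sum (p - 1) 1 x) //; last by lia.
apply: eq_bigr => i _; rewrite /perDs mulrA.
have p0 : p%:R != 0 :> R by rewrite pnatr_eq0; lia.
have := gap i; set g := (_ - _) => g0.
by rewrite mulf_div mulrC [g * _]mulrC divff ?mulr1 // mulf_neq0 // gt_eqF.
Qed.

End Periodic.

Section Open.
Variables (R : realType) (tau : int -> R) (n p : nat) (L : R).
Hypotheses (L0 : 0 < L) (p2 : (2 <= p)%N) (knots : open_C1_knots tau n p L).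

(* Knots outside the range [0, n + p] are unconstrained; clamping them makes the sequence
   monotone without changing the B-splines of the basis. *)
Let clamp (k : int) : R :=
  if k < 0 then 0 else if (n + p)%:Z < k then L else tau k.

Let pn : (p < n)%N. Proof. by case: knots. Qed.

Let clamp_in (k : int) : 0 <= k <= (n + p)%:Z -> clamp k = tau k.
Proof.
by move=> kr; rewrite /clamp; case: ifP => [|_]; [lia | case: ifP => // ?; lia].
Qed.

Let clamp0 (k : int) : k <= p%:Z -> clamp k = 0.
Proof.
case: knots => _ [_ z _ _ _] kp; rewrite /clamp; case: ifP => // k0.
by case: ifP => [|_]; [lia | case: k k0 kp => // k _ kp; apply: z; lia].
Qed.

Let clampL (k : int) : n%:Z <= k -> clamp k = L.
Proof.
case: knots => _ [_ _ z _ _] kp; rewrite /clamp; case: ifP => [|k0]; first by lia.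
by case: ifP => // kn; case: k k0 kp kn => // k _ kp kn; apply: z; lia.
Qed.

Let clamp_mid (k : int) : p%:Z < k < n%:Z -> 0 < clamp k < L.
Proof.
move=> kp; rewrite clamp_in; last by lia.
by case: knots => _ [_ _ _ z _]; case: k kp => // k kp; apply: z; lia.
Qed.

Let mono : forall i j : int, i <= j -> clamp i <= clamp j.
Proof.
apply: int_homo => k.
have [k0|k0] := ltP k 0; first by rewrite !clamp0 //; lia.
have [kn|kn] := ltP k (n + p)%:Z; last by rewrite !clampL //; lia.
rewrite !clamp_in; try lia.
case: knots => _ [z _ _ _ _]; case: k k0 kn => // k _ kn.
by rewrite (_ : k%:Z + 1 = k.+1%:Z); [apply: z | ]; lia.
Qed.

Let simple (k : int) x : 0 < x < L ->
  ~~ ((clamp k == x) && (clamp (k + (p - 1)%:Z) == x)).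
Proof.
move=> /andP[x0 xL]; apply/negP => /andP[/eqP a /eqP b].
have [kp|kp] := leP k p%:Z; first by move: x0; rewrite -a clamp0 // ltxx.
have [kn|kn] := leP n%:Z (k + (p - 1)%:Z).
  by move: xL; rewrite -b clampL // ltxx.
case: knots => _ [_ _ _ _ z]; case: k kp kn a b => // k kp kn a b.
have := z k; rewrite -(clamp_in k); last by lia.
rewrite -(clamp_in (k + p - 1)%N%:Z); last by lia.
rewrite a (_ : (k + p - 1)%N%:Z = k%:Z + (p - 1)%:Z) ?b ?ltxx; lia.
Qed.

Let simple0 (k : int) x : 1 <= k -> 0 <= x < L ->
  ~~ ((clamp k == x) && (clamp (k + p%:Z) == x)).
Proof.
move=> k1 /andP[]; rewrite le_eqVlt => /orP[/eqP <- _|x0 xL].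
  rewrite negb_and; apply/orP; right.
  have [kn|kn] := leP n%:Z (k + p%:Z); first by rewrite clampL // gt_eqF.
  have /andP[h _] : 0 < clamp (k + p%:Z) < L by apply: clamp_mid; lia.
  by rewrite gt_eqF.
have ne : 0 < x < L by rewrite x0 xL.
apply: contra (simple k x ne).
move=> /andP[/eqP a /eqP b]; rewrite a eqxx /= eq_le.
by apply/andP; split; [rewrite -b | rewrite -a]; apply: mono; lia.
Qed.

Let opBsE j : (j < n)%N -> opBs tau p j = bsp clamp p j.
Proof.
move=> jn; apply/funext => x; apply: eq_bsp => k hk; rewrite clamp_in //; lia.
Qed.

Lemma opBs_derive j x : (j < n)%N -> 0 < x < L ->
  is_derive x 1 (opBs tau p j)
    ((if j is j'.+1 then opDs tau p j' x else 0)
     - (if (j < n - 1)%N then opDs tau p j x else 0)).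
Proof.
move=> jn xL.
have [q pq] : exists q, p = q.+1 by exists (p - 1)%N; lia.
have q1 : (p - 1)%N = q by lia.
have D i : (i < n - 1)%N -> opDs tau p i x =
    p%:R / (clamp (i.+1%:Z + p%:Z) - clamp i.+1%:Z) * bsp clamp q i.+1%:Z x.
  move=> hi; rewrite /opDs q1 !addn1 !clamp_in; try lia.
  rewrite (_ : (i + p).+1%:Z = i.+1%:Z + p%:Z); last by lia.
  by congr (_ * _); apply: eq_bsp => k hk; rewrite clamp_in //; lia.
rewrite opBsE //.
have H : is_derive x 1 (bsp clamp p j%:Z)
   (p%:R / (clamp (j%:Z + p%:Z) - clamp j%:Z) * bsp clamp q j%:Z x
     - p%:R / (clamp (j%:Z + p.+1%:Z) - clamp (j%:Z + 1)) * bsp clamp q (j%:Z + 1) x).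
  rewrite pq; apply: bsp_derive => //.
  - by have := simple j%:Z x xL; rewrite q1.
  - by have := simple (j%:Z + 1) x xL; rewrite q1 shift1S.
  - have := simple (j%:Z + 2) x xL.
    by rewrite q1 (_ : j%:Z + 2 + q%:Z = j%:Z + q.+2%:Z) //; lia.
(* For the first and the last spline one of the knot spans is a full end knot, of length 0; its
   inverse is 0, which removes the term. *)
apply: (is_derive_eq H); congr (_ - _).
  case: j jn {H} => [|j] jn; last by rewrite D //; lia.
  by rewrite add0r !clamp0 // subrr invr0 mulr0 mul0r.
rewrite (_ : j%:Z + 1 = j.+1%:Z); last by lia.
case: ifP => jn1; first by rewrite D // (_ : j%:Z + p.+1%:Z = j.+1%:Z + p%:Z) //; lia.
by rewrite !clampL ?subrr ?invr0 ?mulr0 ?mul0r //; lia.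
Qed.

Lemma opBs_sum1 x : 0 < x < L -> \sum_(j < n) opBs tau p j x = 1.
Proof.
move=> /andP[x0 xL].
rewrite -[RHS](@bsp_sum1 _ clamp mono p 0 n x).
- by apply: eq_bigr => j _; rewrite opBsE // add0r.
- by rewrite add0r clamp0 // ltW.
- by rewrite add0r clampL.
Qed.

Lemma opBs_continuous j x : (0 < j < n)%N -> 0 <= x < L ->
  {for x, continuous (opBs tau p j)}.
Proof.
move=> jn xL; rewrite opBsE; last by lia.
have [q pq] : exists q, p = q.+1 by exists (p - 1)%N; lia.
rewrite pq; apply: bsp_continuous => //; rewrite -pq; first by apply: simple0 => //; lia.
by rewrite -shift1S; apply: simple0 => //; lia.
Qed.

(** The spline of the clamped knots vanishes left of 0, and continuity carries the zero over to
    0. *)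
Lemma opBs_at0 j : (0 < j < n)%N -> opBs tau p j 0 = 0.
Proof.
move=> jn.
have c0 : {for 0, continuous (opBs tau p j)}.
  by apply: opBs_continuous => //; rewrite lexx.
apply/eqP/negPn/negP => ne.
move/cvgrPdist_lt : c0 => /(_ `|opBs tau p j 0|); rewrite normr_gt0 => /(_ ne) near0.
have : \forall y \near (0 : R), y < 0 -> False.
  apply: filterS near0 => y hy y0; move: hy.
  rewrite opBsE; last by lia.
  rewrite [bsp _ _ _ y](@bsp_out_left _ _ mono) ?subr0 ?ltxx //.
  by apply: (lt_le_trans y0); rewrite -[leLHS](@clamp0 0) //; apply: mono.
move=> /nbhs_ballP[e /= e0 /(_ (- (e / 2)))]; rewrite /ball /= sub0r opprK.
rewrite gtr0_norm ?divr_gt0 // ltr_pdivrMr // ltr_pMr //; lra.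
Qed.

End Open.

(** * Row spaces of the extraction matrices *)

(** Coefficients live on [nat], so that the shifts in finite differences need no casts between
    ordinals. *)
Definition tens {R : realType} (a b c : nat) (f g h : nat -> R -> R)
    (C : nat -> nat -> nat -> R) : R -> R -> R -> R :=
  fun r s t => \sum_(i < a) \sum_(j < b) \sum_(k < c) C i j k * (f i r * g j s * h k t).

Lemma eq_tens (R : realType) a b c (f g h : nat -> R -> R) C C' r s t :
  (forall i j k, (i < a)%N -> (j < b)%N -> (k < c)%N -> C i j k = C' i j k) ->
  tens a b c f g h C r s t = tens a b c f g h C' r s t.
Proof.
by move=> H; apply: eq_bigr => i _; apply: eq_bigr => j _; apply: eq_bigr => k _; rewrite H.
Qed.

Section FiniteSums.
Variable R : realType.

Lemma sum_pick N l0 (F : nat -> R) : (l0 < N)%N ->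
  (forall l, (l < N)%N -> l != l0 -> F l = 0) -> \sum_(l < N) F l = F l0.
Proof.
move=> lN H; rewrite (bigD1 (Ordinal lN)) //= big1 ?addr0 // => l ll.
by apply: H.
Qed.

Lemma sum_first2 N (F : nat -> R) : (2 <= N)%N ->
  \sum_(l < N) F l = F 0%N + F 1%N + \sum_(l < N - 2) F l.+2.
Proof.
by case: N => [|[|N]] // _; rewrite !big_ord_recl /= addrA subn2.
Qed.

Lemma sum_first3 N (F : nat -> R) : (3 <= N)%N ->
  \sum_(l < N) F l = F 0%N + F 1%N + F 2%N + \sum_(l < N - 3) F l.+3.
Proof.
by case: N => [|[|[|N]]] // _; rewrite !big_ord_recl /= !addrA subSS subn2.
Qed.

Lemma extend_coefs n m (a : 'I_n * 'I_m -> R) :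
  exists a' : nat -> nat -> R, forall k l, a (k, l) = a' k l.
Proof.
exists (fun k l => if insub k is Some k' then if insub l is Some l' then a (k', l') else 0 else 0).
by move=> k l; rewrite !valK.
Qed.

Lemma sum_mxfun_tens nr m nt N (f g h : nat -> R -> R) (M : 'M[R]_(N, nr * m))
    (M' : nat -> nat -> R) (a : 'I_nt * 'I_N -> R) (a' : nat -> nat -> R) r s t :
  (0 < nr)%N ->
  (forall l c, M l c = M' l c) -> (forall k l, a (k, l) = a' k l) ->
  \sum_kl a kl * (mxfun M (fun c x y => f (c %% nr)%N x * g (c %/ nr)%N y) kl.2 r s * h kl.1 t)
  = tens nr m nt f g h (fun i j k => \sum_(l < N) a' k l * M' l (i + j * nr)%N) r s t.
Proof.
move=> nr0 HM Ha.
rewrite (eq_bigr (fun kl : 'I_nt * 'I_N => \sum_(c < nr * m)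
   a' kl.1 kl.2 * M' kl.2 c * (f (c %% nr)%N r * g (c %/ nr)%N s * h kl.1 t))); last first.
  move=> [k l] _; rewrite /mxfun /= mulr_suml mulr_sumr Ha; apply: eq_bigr => c _.
  by rewrite HM; ring.
rewrite exchange_big /=.
rewrite (sum_prod_nat _ nr m (fun c => \sum_(kl : 'I_nt * 'I_N)
   a' kl.1 kl.2 * M' kl.2 c * (f (c %% nr)%N r * g (c %/ nr)%N s * h kl.1 t))).
apply: eq_bigr => i _; apply: eq_bigr => j _.
rewrite -(pair_bigA _ (fun (k : 'I_nt) (l : 'I_N) => a' k l * M' l (i + j * nr)%N *
   (f ((i + j * nr) %% nr)%N r * g ((i + j * nr) %/ nr)%N s * h k t))) /=.
apply: eq_bigr => k _; rewrite mulr_suml; apply: eq_bigr => l _.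
by rewrite addnC modnMDl modn_small // divnMDl // divn_small // addn0.
Qed.

Lemma col_mx_topE n1 n2 N (A : 'M[R]_(n1, N)) (A' : nat -> nat -> R) :
  (forall l c, A l c = A' l c) ->
  forall l c, col_mx A (0 : 'M[R]_(n2, N)) l c = if (l < n1)%N then A' l c else 0.
Proof.
by move=> H l c; rewrite mxE; case: splitP => j lj; rewrite ?H ?lj // mxE.
Qed.

Lemma col_mx_botE n1 n2 N (A : 'M[R]_(n2, N)) (A' : nat -> nat -> R) :
  (forall l c, A l c = A' l c) ->
  forall l c, col_mx (0 : 'M[R]_(n1, N)) A l c = if (l < n1)%N then 0 else A' (l - n1)%N c.
Proof.
by move=> H l c; rewrite mxE; case: splitP => j lj; rewrite ?mxE // H lj addKn.
Qed.

Lemma sum_top n1 n2 (a F : nat -> R) :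
  \sum_(l < n1 + n2) a l * (if (l < n1)%N then F l else 0) = \sum_(l < n1) a l * F l.
Proof.
rewrite big_split_ord /= [X in _ + X]big1 ?addr0; last first.
  by move=> l _; rewrite ltnNge leq_addr mulr0.
by apply: eq_bigr => l _; rewrite ltn_ord.
Qed.

Lemma sum_bot n1 n2 (a F : nat -> R) :
  \sum_(l < n1 + n2) a l * (if (l < n1)%N then 0 else F (l - n1)%N)
  = \sum_(l < n2) a (n1 + l)%N * F l.
Proof.
rewrite big_split_ord /= big1 ?add0r; last by move=> l _; rewrite ltn_ord mulr0.
by apply: eq_bigr => l _; rewrite ltnNge leq_addr addKn.
Qed.

End FiniteSums.

Section Polar.
Variables (R : realType) (nr ns : nat).
Hypotheses (nr0 : (0 < nr)%N) (ns3 : (3 <= ns)%N).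

(** Offsets of the second ring from the centroid in barycentric coordinates. Columns of [Ebar] sum
    to 1, so the offset in row 0 is [- u - v]. *)
Definition polar_u i : R := Ebar R nr 1 i 1 - 1 / 3.
Definition polar_v i : R := Ebar R nr 2 i 1 - 1 / 3.
Notation u := polar_u.
Notation v := polar_v.

(* [polar0] is the row space of E^(0): the value [q] at the polar edge and two slopes are free.
   [polar1] is the joint row space of E^(1,0) and E^(0,1), which share their first two rows'
   coefficients, again the slopes. *)
Definition polar0 (C : nat -> nat -> nat -> R) :=
  exists q al be : nat -> R, forall i k, (i < nr)%N ->
    C i 0%N k = q k /\ C i 1%N k = q k + al k * u i + be k * v i.

Definition polar1 (X Z : nat -> nat -> nat -> R) :=
  exists al be : nat -> R, forall i k, (i < nr)%N ->
    [/\ X i 0%N k = 0,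
        X i 1%N k = al k * (u (i.+1 %% nr)%N - u i) + be k * (v (i.+1 %% nr)%N - v i) &
        Z i 0%N k = al k * u i + be k * v i].

Definition polar2 (Y : nat -> nat -> nat -> R) :=
  forall i k, (i < nr)%N -> Y i 0%N k = 0.

Definition e0 (l c : nat) : R :=
  if (l < 3)%N then (if (c < 2 * nr)%N then Ebar R nr l (c %% nr)%N (c %/ nr)%N else 0)
  else (if (2 * nr <= c)%N && (l - 3 == c - 2 * nr)%N then 1 else 0).
Definition e10 (l c : nat) : R :=
  if (l < 2)%N then
    (if (nr <= c < 2 * nr)%N
     then Ebar R nr l.+1 ((c - nr).+1 %% nr)%N 1 - Ebar R nr l.+1 (c - nr)%N 1 else 0)
  else
    (if odd ((l - 2) %/ nr) && (c == (l - 2) %% nr + ((l - 2) %/ nr + 3)./2 * nr)%N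
     then 1 else 0).
Definition e01 (l c : nat) : R :=
  if (l < 2)%N then
    (if (c < nr)%N then Ebar R nr l.+1 c 1 - Ebar R nr l.+1 c 0 else 0)
  else
    (if ~~ odd ((l - 2) %/ nr) && (c == (l - 2) %% nr + (((l - 2) %/ nr)./2 + 1) * nr)%N
     then 1 else 0).
Definition e2 (l c : nat) : R := if (c == l + nr)%N then 1 else 0.

Lemma E0E l c : E0 R nr ns l c = e0 l c. Proof. by rewrite mxE. Qed.
Lemma E10E l c : E10 R nr ns l c = e10 l c. Proof. by rewrite mxE. Qed.
Lemma E01E l c : E01 R nr ns l c = e01 l c. Proof. by rewrite mxE. Qed.
Lemma E2E l c : E2 R nr ns l c = e2 l c. Proof. by rewrite mxE. Qed.

Let modd (i j : nat) : (i < nr)%N -> ((i + j * nr) %% nr)%N = i.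
Proof. by move=> h; rewrite addnC modnMDl modn_small. Qed.
Let divd (i j : nat) : (i < nr)%N -> ((i + j * nr) %/ nr)%N = j.
Proof. by move=> h; rewrite addnC divnMDl // divn_small // addn0. Qed.

Lemma sum_e0_edge (b : nat -> R) i : (i < nr)%N ->
  \sum_(l < n0bar nr ns) b l * e0 l (i + 0 * nr)%N = (b 0%N + b 1%N + b 2%N) / 3 /\
  \sum_(l < n0bar nr ns) b l * e0 l (i + 1 * nr)%N
    = (b 0%N + b 1%N + b 2%N) / 3 + (b 1%N - b 0%N) * u i + (b 2%N - b 0%N) * v i.
Proof.
move=> ir.
have F c : (c < 2 * nr)%N -> \sum_(l < n0bar nr ns) b l * e0 l c =
    b 0%N * e0 0 c + b 1%N * e0 1 c + b 2%N * e0 2 c.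
  move=> c2; rewrite (sum_first3 _ _ (fun l => b l * e0 l c)); last by rewrite /n0bar; exact: leq_addl.
  by rewrite big1 ?addr0 // => l _; rewrite /e0 /= leqNgt c2 mulr0.
split; (rewrite F; last by lia).
- by rewrite /e0 /= (_ : (_ < 2 * nr)%N); [rewrite divd // /Ebar /=; lra | lia].
- rewrite /e0 /= (_ : (_ < 2 * nr)%N); last by lia.
  by rewrite divd // modd // /u /v /Ebar /=; lra.
Qed.

Lemma sum_e0_inner (b : nat -> R) i j : (i < nr)%N -> (2 <= j < ns)%N ->
  \sum_(l < n0bar nr ns) b l * e0 l (i + j * nr)%N = b (3 + (i + (j - 2) * nr))%N.
Proof.
move=> ir jn; rewrite (sum_pick _ _ (3 + (i + (j - 2) * nr))%N (fun l => b l * e0 l (i + j * nr)%N)).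
- rewrite /e0 /= (_ : (2 * nr <= _)%N) /=; last by nia.
  by rewrite (_ : _ == _) ?mulr1 //; apply/eqP; nia.
- by rewrite /n0bar; nia.
- move=> l ln ll; rewrite /e0; case: ifP => l3.
    by rewrite (_ : (_ < _)%N = false) ?mulr0 //; nia.
  case: ifP => [/andP[_ /eqP h] | _]; rewrite ?mulr0 //; exfalso; move/eqP: ll; apply; nia.
Qed.

Lemma polar0_coef (C : nat -> nat -> nat -> R) : polar0 C ->
  exists b : nat -> nat -> R, forall i j k, (i < nr)%N -> (j < ns)%N ->
    \sum_(l < n0bar nr ns) b k l * e0 l (i + j * nr)%N = C i j k.
Proof.
move=> [q [al [be H]]].
(* The three polar coefficients are [y], [y + al], [y + be]; their mean has to be [q]. *)
pose y k := q k - (al k + be k) / 3.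
pose b k l := if l == 0%N then y k else if l == 1%N then y k + al k
   else if l == 2%N then y k + be k else C ((l - 3) %% nr)%N ((l - 3) %/ nr + 2)%N k.
exists b => i j k ir js; have [C0 C1] := H i k ir.
case: j js => [|[|j]] js.
- by rewrite (proj1 (sum_e0_edge (b k) i ir)) C0 /b /= /y; lra.
- by rewrite (proj2 (sum_e0_edge (b k) i ir)) C1 /b /= /y; lra.
- by rewrite (sum_e0_inner (b k)) // /b /= addKn subn2 /= modd // divd // addn2.
Qed.

Lemma sum_e10_edge (b : nat -> R) i : (i < nr)%N ->
  \sum_(l < n1bar nr ns) b l * e10 l (i + 0 * nr)%N = 0 /\
  \sum_(l < n1bar nr ns) b l * e10 l (i + 1 * nr)%N
    = b 0%N * (u (i.+1 %% nr)%N - u i) + b 1%N * (v (i.+1 %% nr)%N - v i).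
Proof.
move=> ir.
have Z j l : (j < 2)%N -> b l.+2 * e10 l.+2 (i + j * nr)%N = 0.
  move=> j2; rewrite /e10 /= !subSS subn0; case: ifP => [/andP[oq /eqP h] | _]; last by rewrite mulr0.
  exfalso; have lt := ltn_pmod l nr0; move: h lt oq.
  move: (l %/ nr)%N (l %% nr)%N => q m h lt oq.
  have : (2 <= (q + 3)./2)%N by lia.
  by move: ((q + 3)./2) h => x h x2; nia.
have F j : (j < 2)%N -> \sum_(l < n1bar nr ns) b l * e10 l (i + j * nr)%N =
    b 0%N * e10 0 (i + j * nr)%N + b 1%N * e10 1 (i + j * nr)%N.
  move=> j2; rewrite (sum_first2 _ _ (fun l => b l * e10 l (i + j * nr)%N)).
    by rewrite big1 ?addr0 // => l _; apply: Z.
  by rewrite /n1bar /n0bar; nia.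
split; rewrite F //.
- by rewrite /e10 /= (_ : (nr <= _)%N = false) ?mulr0 ?addr0 //; lia.
- rewrite /e10 /= (_ : (_ <= _ < _)%N); last by lia.
  by rewrite mul1n addnK /u /v; ring.
Qed.

(** After the first two rows, blocks of [nr] rows alternate between the components: block
    [2 * j - 3] carries ring [j] of [E10], block [2 * j - 2] ring [j] of [E01]. Away from the edge
    the two arrays are therefore independent. *)
Lemma sum_e10_inner (b : nat -> R) i j : (i < nr)%N -> (2 <= j < ns)%N ->
  \sum_(l < n1bar nr ns) b l * e10 l (i + j * nr)%N = b (2 + (i + (2 * j - 3) * nr))%N.
Proof.
move=> ir jn; rewrite (sum_pick _ _ (2 + (i + (2 * j - 3) * nr))%N (fun l => b l * e10 l (i + j * nr)%N)).
- rewrite /e10 /= addKn modd // divd // (_ : odd _) /=; last by lia.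
  by rewrite (_ : _./2 = j) ?eqxx ?mulr1 //; lia.
- by rewrite /n1bar /n0bar; nia.
- move=> l ln ll; rewrite /e10; case: ifP => l2.
    by rewrite (_ : (_ <= _ < _)%N = false) ?mulr0 //; nia.
  case: ifP => [/andP[oq /eqP h] | _]; rewrite ?mulr0 //; exfalso; move/eqP: ll; apply.
  have lm := divn_eq (l - 2) nr; have lt := ltn_pmod (l - 2) nr0.
  move: h lm lt oq; move: ((l - 2) %/ nr)%N ((l - 2) %% nr)%N => q m h lm lt oq.
  have E : i = m by rewrite -(modd i j ir) h modd.
  have E' : j = ((q + 3)./2)%N by rewrite -(divd i j ir) h divd.
  by rewrite E; have -> : (2 * j - 3 = q)%N by [lia]; lia.
Qed.

Lemma sum_e01_edge (b : nat -> R) i : (i < nr)%N ->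
  \sum_(l < n1bar nr ns) b l * e01 l (i + 0 * nr)%N = b 0%N * u i + b 1%N * v i.
Proof.
move=> ir; rewrite (sum_first2 _ _ (fun l => b l * e01 l (i + 0 * nr)%N)); last by rewrite /n1bar /n0bar; nia.
rewrite big1 ?addr0; last first.
  move=> l _; rewrite /e01 /= !subSS subn0; case: ifP => [/andP[oq /eqP h] | _]; last by rewrite mulr0.
  by exfalso; nia.
by rewrite /e01 /= addn0 ir /u /v /Ebar /=; ring.
Qed.

Lemma sum_e01_inner (b : nat -> R) i j : (i < nr)%N -> (1 <= j < ns - 1)%N ->
  \sum_(l < n1bar nr ns) b l * e01 l (i + j * nr)%N = b (2 + (i + (2 * j - 2) * nr))%N.
Proof.
move=> ir jn; rewrite (sum_pick _ _ (2 + (i + (2 * j - 2) * nr))%N (fun l => b l * e01 l (i + j * nr)%N)).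
- rewrite /e01 /= addKn modd // divd // (_ : ~~ odd _) /=; last by lia.
  by rewrite (_ : (_./2 + 1)%N = j) ?eqxx ?mulr1 //; lia.
- by rewrite /n1bar /n0bar; nia.
- move=> l ln ll; rewrite /e01; case: ifP => l2.
    by rewrite (_ : (_ < _)%N = false) ?mulr0 //; nia.
  case: ifP => [/andP[oq /eqP h] | _]; rewrite ?mulr0 //; exfalso; move/eqP: ll; apply.
  have lm := divn_eq (l - 2) nr; have lt := ltn_pmod (l - 2) nr0.
  move: h lm lt oq; move: ((l - 2) %/ nr)%N ((l - 2) %% nr)%N => q m h lm lt oq.
  have E : i = m by rewrite -(modd i j ir) h modd.
  have E' : j = (q./2 + 1)%N by rewrite -(divd i j ir) h divd.
  by rewrite E; have -> : (2 * j - 2 = q)%N by [lia]; lia.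
Qed.

Lemma polar1_coef (X Z : nat -> nat -> nat -> R) : polar1 X Z ->
  exists b : nat -> nat -> R,
    (forall i j k, (i < nr)%N -> (j < ns)%N ->
      \sum_(l < n1bar nr ns) b k l * e10 l (i + j * nr)%N = X i j k) /\
    (forall i j k, (i < nr)%N -> (j < ns - 1)%N ->
      \sum_(l < n1bar nr ns) b k l * e01 l (i + j * nr)%N = Z i j k).
Proof.
move=> [al [be H]].
pose b k l := if l == 0%N then al k else if l == 1%N then be k
   else if odd ((l - 2) %/ nr) then X ((l - 2) %% nr)%N ((l - 2) %/ nr + 3)./2 k
   else Z ((l - 2) %% nr)%N (((l - 2) %/ nr)./2 + 1)%N k.
exists b; split=> i j k ir js; have [X0 X1 Z0] := H i k ir.
- case: j js => [|[|j]] js.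
  + by rewrite (proj1 (sum_e10_edge (b k) i ir)) X0.
  + by rewrite (proj2 (sum_e10_edge (b k) i ir)) X1.
  + rewrite (sum_e10_inner (b k)) // /b /= addKn modd // divd //.
    rewrite (_ : odd _); last by lia.
    by congr (X _ _ _); lia.
- case: j js => [|j] js; first by rewrite (sum_e01_edge (b k)) // Z0.
  rewrite (sum_e01_inner (b k)) // /b /= addKn modd // divd //.
  rewrite (_ : odd _ = false); last by lia.
  by congr (Z _ _ _); lia.
Qed.

Lemma sum_e2 (b : nat -> R) i j : (i < nr)%N -> (j < ns - 1)%N ->
  \sum_(l < n2bar nr ns) b l * e2 l (i + j * nr)%N =
    if j is j'.+1 then b (i + j' * nr)%N else 0.
Proof.
case: j => [|j] ir js.
  by rewrite big1 // => l _; rewrite /e2 (_ : _ == _ = false) ?mulr0 //; lia.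
rewrite (sum_pick _ _ (i + j * nr)%N (fun l => b l * e2 l (i + j.+1 * nr)%N)).
- by rewrite /e2 (_ : _ == _) ?mulr1 //; apply/eqP; lia.
- by rewrite /n2bar /n0bar; nia.
- by move=> l _ ll; rewrite /e2 (_ : _ == _ = false) ?mulr0 //; apply/negP => /eqP h; lia.
Qed.

Lemma polar2_coef (Y : nat -> nat -> nat -> R) : polar2 Y ->
  exists b : nat -> nat -> R, forall i j k, (i < nr)%N -> (j < ns - 1)%N ->
    \sum_(l < n2bar nr ns) b k l * e2 l (i + j * nr)%N = Y i j k.
Proof.
move=> H; exists (fun k l => Y (l %% nr)%N (l %/ nr).+1 k) => i j k ir js.
rewrite (sum_e2 (fun l => Y (l %% nr)%N (l %/ nr).+1 k)) //.
by case: j js => [|j] js; [rewrite H | rewrite modd // divd].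
Qed.

End Polar.

(** * Tensor-product splines *)

Section MeanValue.
Variable R : realType.

(** With [l = 0] it propagates the zero at the polar edge; with unknown [l] it turns equal values at
    the ends of a period into [l = 0]. *)
Lemma increment_cst_derive (f : R -> R) (a b l : R) : a < b ->
  (forall x, a < x < b -> is_derive x 1 f l) ->
  (forall x, a <= x <= b -> {for x, continuous f}) ->
  f b - f a = l * (b - a).
Proof.
move=> ab D C; have Cf : {within `[a, b], continuous f}.
  by apply: continuous_in_subspaceT => x; rewrite inE /=; exact: C.
have Df x : x \in `]a, b[%R -> is_derive x 1 f l by rewrite in_itv /=; exact: D.
by have [c _ ->] := MVT ab Df Cf.
Qed.

Lemma eq_zero_derive (f : R -> R) (a b x y : R) :
  (forall z, a < z < b -> is_derive z 1 f 0) -> a < x < b -> a < y < b -> f x = f y.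
Proof.
move=> D; wlog xy : x y / x < y => [W hx hy|].
  by have [xy|xy|->//] := ltgtP x y; [apply: W | apply/esym/W].
move=> /andP[ax xb] /andP[ay yb].
have dz z : x <= z <= y -> is_derive z 1 f 0.
  by move=> /andP[xz zy]; apply: D; rewrite (lt_le_trans ax) // (le_lt_trans zy).
have := @increment_cst_derive f x y 0 xy; rewrite mul0r => E.
apply/esym/eqP; rewrite -subr_eq0; apply/eqP; apply: E => z hz.
  by apply: dz; case/andP: hz => /ltW -> /ltW.
exact: is_derive_continuous (dz z hz).
Qed.

End MeanValue.

Section Tensor.
Variables (R : realType) (a b c : nat).
Implicit Types (f g h : nat -> R -> R) (C : nat -> nat -> nat -> R).

Lemma tens_r f g h C r s t : tens a b c f g h C r s t =
  \sum_(i < a) (\sum_(j < b) \sum_(k < c) C i j k * (g j s * h k t)) * f i r.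
Proof.
apply: eq_bigr => i _; rewrite mulr_suml; apply: eq_bigr => j _.
by rewrite mulr_suml; apply: eq_bigr => k _; ring.
Qed.

Lemma tens_s f g h C r s t : tens a b c f g h C r s t =
  \sum_(j < b) (\sum_(i < a) \sum_(k < c) C i j k * (f i r * h k t)) * g j s.
Proof.
rewrite /tens exchange_big; apply: eq_bigr => j _; rewrite mulr_suml.
apply: eq_bigr => i _; rewrite mulr_suml; apply: eq_bigr => k _; ring.
Qed.

Lemma tens_t f g h C r s t : tens a b c f g h C r s t =
  \sum_(k < c) (\sum_(i < a) \sum_(j < b) C i j k * (f i r * g j s)) * h k t.
Proof.
rewrite /tens; under eq_bigr do rewrite exchange_big.
rewrite exchange_big; apply: eq_bigr => k _; rewrite mulr_suml.
apply: eq_bigr => i _; rewrite mulr_suml; apply: eq_bigr => j _; ring.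
Qed.

Lemma tensD f g h C C' r s t :
  tens a b c f g h (fun i j k => C i j k + C' i j k) r s t =
  tens a b c f g h C r s t + tens a b c f g h C' r s t.
Proof.
rewrite /tens -big_split; apply: eq_bigr => i _; rewrite -big_split; apply: eq_bigr => j _.
by rewrite -big_split; apply: eq_bigr => k _; rewrite /= mulrDl.
Qed.

Lemma tensN f g h C r s t :
  tens a b c f g h (fun i j k => - C i j k) r s t = - tens a b c f g h C r s t.
Proof.
rewrite /tens -sumrN; apply: eq_bigr => i _; rewrite -sumrN; apply: eq_bigr => j _.
by rewrite -sumrN; apply: eq_bigr => k _; rewrite mulNr.
Qed.

Lemma tensB f g h C C' r s t :
  tens a b c f g h (fun i j k => C i j k - C' i j k) r s t =
  tens a b c f g h C r s t - tens a b c f g h C' r s t.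
Proof. by rewrite -tensN -tensD. Qed.

Lemma tens0 f g h r s t : tens a b c f g h (fun _ _ _ => 0) r s t = 0.
Proof.
by rewrite /tens !big1 // => i _; rewrite big1 // => j _; rewrite big1 // => k _; rewrite mul0r.
Qed.

Lemma tens_sum1 f g h (w : nat -> R) r s t :
  \sum_(i < a) f i r = 1 -> \sum_(j < b) g j s = 1 ->
  tens a b c f g h (fun _ _ k => w k) r s t = \sum_(k < c) w k * h k t.
Proof.
move=> f1 g1; rewrite tens_t; apply: eq_bigr => k _; congr (_ * _).
under eq_bigr do rewrite -mulr_sumr -mulr_sumr g1 mulr1.
by rewrite -mulr_sumr f1 mulr1.
Qed.

End Tensor.

Definition diff_r {R : realType} n (C : nat -> nat -> nat -> R) i j k := C (i.+1 %% n)%N j k - C i j k.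
Definition diff_s {R : realType} (C : nat -> nat -> nat -> R) i j k := C i j.+1 k - C i j k.
Definition diff_t {R : realType} n (C : nat -> nat -> nat -> R) i j k := C i j (k.+1 %% n)%N - C i j k.
(** The empty sum at [j = 0] is the integration constant: the antiderivative is 0 on the polar
    edge. *)
Definition int_s {R : realType} (C : nat -> nat -> nat -> R) i j k := \sum_(m < j) C i m k.

Lemma diff_int_s (R : realType) (C : nat -> nat -> nat -> R) i j k :
  diff_s (int_s C) i j k = C i j k.
Proof. by rewrite /diff_s /int_s big_ord_recr /= addrAC subrr add0r. Qed.

(** Partial sums satisfy every equation but the wrap from [n - 1] to 0, which closes because the
    total is zero. *)
Lemma cyclic_int (R : realType) n (x : nat -> R) : \sum_(k < n) x k = 0 ->
  exists y : nat -> R, forall k, (k < n)%N -> y (k.+1 %% n)%N - y k = x k.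
Proof.
move=> x0; exists (fun k => \sum_(m < k) x m) => k kn.
have [kl|kl] := ltnP k.+1 n; first by rewrite modn_small // big_ord_recr /= addrAC subrr add0r.
have E : k.+1 = n by apply/eqP; rewrite eqn_leq kn kl.
move: x0; rewrite -E big_ord_recr /= modnn big_ord0 => x0.
by rewrite sub0r; apply/esym/eqP; rewrite -addr_eq0 addrC x0.
Qed.

Section Field3.
Variable R : realType.
Implicit Types (a b c : R -> R -> R -> R) (F : 'I_3 -> R -> R -> R -> R).

Lemma cmp3_vec3 a b c :
  [/\ cmp3 (vec3 a b c) 0 = a, cmp3 (vec3 a b c) 1 = b & cmp3 (vec3 a b c) 2 = c].
Proof. by split; rewrite /cmp3 /vec3 /= inordK. Qed.

Lemma eqbox3 Lr Ls Lt F a b c :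
  eqbox Lr Ls Lt F (vec3 a b c) <->
  forall r s t, inbox Lr Ls Lt r s t ->
    [/\ cmp3 F 0 r s t = a r s t, cmp3 F 1 r s t = b r s t & cmp3 F 2 r s t = c r s t].
Proof.
have [e0 e1 e2] := cmp3_vec3 a b c.
split=> [H r s t B|H i r s t B].
  by split; rewrite {1}/cmp3 H // -/(cmp3 _ _) ?e0 ?e1 ?e2.
have [h0 h1 h2] := H r s t B; rewrite -(inord_val i).
case: i => -[|[|[|//]]] hi /=; rewrite -/(cmp3 F _) -/(cmp3 (vec3 a b c) _).
- by rewrite h0 e0.
- by rewrite h1 e1.
- by rewrite h2 e2.
Qed.

Lemma eqbox3_zero Lr Ls Lt a b c :
  eqbox Lr Ls Lt (vec3 a b c) (@zerof R 3) <->
  forall r s t, inbox Lr Ls Lt r s t -> [/\ a r s t = 0, b r s t = 0 & c r s t = 0].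
Proof.
have [e0 e1 e2] := cmp3_vec3 a b c; split=> [H r s t B|H i r s t B].
  by split; [rewrite -e0 | rewrite -e1 | rewrite -e2]; rewrite /cmp3 H.
by have [h0 h1 h2] := H r s t B; rewrite /vec3 /zerof; do 2?case: ifP.
Qed.

End Field3.

(** * The spline complex *)

Section Complex.
Variables (R : realType) (Lr Ls Lt : R) (pr ps pt nr ns nt : nat) (tr ts tt : int -> R).
Hypotheses (Lr0 : 0 < Lr) (Ls0 : 0 < Ls) (Lt0 : 0 < Lt).
Hypotheses (pr2 : (2 <= pr)%N) (ps2 : (2 <= ps)%N) (pt2 : (2 <= pt)%N).
Hypotheses (knots_r : periodic_C1_knots tr nr pr Lr)
  (knots_s : open_C1_knots ts ns ps Ls) (knots_t : periodic_C1_knots tt nt pt Lt).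

Notation BR := (perBs tr nr pr).
Notation DR := (perDs tr nr pr).
Notation BS := (opBs ts ps).
Notation DS := (opDs ts ps).
Notation BT := (perBs tt nt pt).
Notation DT := (perDs tt nt pt).
Notation box := (inbox Lr Ls Lt).
Notation coefs := (nat -> nat -> nat -> R).

Let nr0 : (0 < nr)%N. Proof. by case: knots_r. Qed.
Let ns3 : (3 <= ns)%N. Proof. by case: knots_s => pn _; apply: leq_trans pn. Qed.

(** * Coefficient descriptions of the four spaces *)

Let inV0P (F : field R 1) : inV0 Lr Ls Lt pr ps pt nr ns nt tr ts tt F <->
  exists2 C, polar0 R nr C & forall r s t, box r s t -> F ord0 r s t = tens nr ns nt BR BS BT C r s t.
Proof.
split=> [[a Fa]|[C PC FC]].
  have [a' Ha] := extend_coefs _ _ _ a.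
  exists (fun i j k => \sum_(l < n0bar nr ns) a' k l * e0 R nr l (i + j * nr)%N); last first.
    move=> r s t B; rewrite Fa //; exact: (sum_mxfun_tens _ _ _ _ _ _ _ _ _ _ _ _ _ _ _ nr0 (E0E R nr ns) Ha).
  exists (fun k => (a' k 0%N + a' k 1%N + a' k 2%N) / 3).
  exists (fun k => a' k 1%N - a' k 0%N), (fun k => a' k 2%N - a' k 0%N) => i k ir.
  exact: sum_e0_edge.
have [b Hb] := polar0_coef _ _ ns nr0 ns3 C PC.
exists (fun kl : 'I_nt * 'I_(n0bar nr ns) => b kl.1 kl.2) => c r s t B.
rewrite (ord1 c) FC //; apply: esym.
apply: (etrans (sum_mxfun_tens _ _ _ _ _ _ _ _ _ _ (fun kl => b kl.1 kl.2) b _ _ _ nr0 (E0E R nr ns) (fun k l => erefl _)) _).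
by apply: eq_tens => i j k *; rewrite Hb.
Qed.

Let inV3P (F : field R 1) : inV3 Lr Ls Lt pr ps pt nr ns nt tr ts tt F <->
  exists2 Y, polar2 R nr Y &
    forall r s t, box r s t -> F ord0 r s t = tens nr (ns - 1) nt DR DS DT Y r s t.
Proof.
split=> [[a Fa]|[C PC FC]].
  have [a' Ha] := extend_coefs _ _ _ a.
  exists (fun i j k => \sum_(l < n2bar nr ns) a' k l * e2 R nr l (i + j * nr)%N); last first.
    move=> r s t B; rewrite Fa //; exact: (sum_mxfun_tens _ _ _ _ _ _ _ _ _ _ _ _ _ _ _ nr0 (E2E R nr ns) Ha).
  by move=> i k ir; rewrite sum_e2 //; lia.
have [b Hb] := polar2_coef _ _ ns nr0 ns3 C PC.
exists (fun kl : 'I_nt * 'I_(n2bar nr ns) => b kl.1 kl.2) => c r s t B.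
rewrite (ord1 c) FC //; apply: esym.
apply: (etrans (sum_mxfun_tens _ _ _ _ _ _ _ _ _ _ (fun kl => b kl.1 kl.2) b _ _ _ nr0 (E2E R nr ns) (fun k l => erefl _)) _).
by apply: eq_tens => i j k *; rewrite Hb.
Qed.

Let tens_top n1 n2 N (f g h : nat -> R -> R) (A : 'M[R]_(n1, nr * N)) (A' : nat -> nat -> R)
    (a : 'I_nt * 'I_(n1 + n2) -> R) (a' : nat -> nat -> R) r s t :
  (forall l c, A l c = A' l c) -> (forall k l, a (k, l) = a' k l) ->
  \sum_(kl : 'I_nt * 'I_(n1 + n2))
    a kl * (mxfun (col_mx A 0) (fun c x y => f (c %% nr)%N x * g (c %/ nr)%N y) kl.2 r s * h kl.1 t)
  = tens nr N nt f g h (fun i j k => \sum_(l < n1) a' k l * A' l (i + j * nr)%N) r s t.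
Proof.
move=> HA Ha.
apply: (etrans (sum_mxfun_tens _ _ _ _ _ _ _ _ _ (fun l c => if (l < n1)%N then A' l c else 0) _ a' _ _ _ nr0 (col_mx_topE _ _ _ _ _ _ HA) Ha) _).
by apply: eq_tens => i j k *; rewrite (sum_top _ n1 n2 (a' k) (fun l => A' l (i + j * nr)%N)).
Qed.

Let tens_bot n1 n2 N (f g h : nat -> R -> R) (A : 'M[R]_(n2, nr * N)) (A' : nat -> nat -> R)
    (a : 'I_nt * 'I_(n1 + n2) -> R) (a' : nat -> nat -> R) r s t :
  (forall l c, A l c = A' l c) -> (forall k l, a (k, l) = a' k l) ->
  \sum_(kl : 'I_nt * 'I_(n1 + n2))
    a kl * (mxfun (col_mx 0 A) (fun c x y => f (c %% nr)%N x * g (c %/ nr)%N y) kl.2 r s * h kl.1 t)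
  = tens nr N nt f g h (fun i j k => \sum_(l < n2) a' k (n1 + l)%N * A' l (i + j * nr)%N) r s t.
Proof.
move=> HA Ha.
apply: (etrans (sum_mxfun_tens _ _ _ _ _ _ _ _ _ (fun l c => if (l < n1)%N then 0 else A' (l - n1)%N c) _ a' _ _ _ nr0 (col_mx_botE _ _ _ _ _ _ HA) Ha) _).
by apply: eq_tens => i j k *; rewrite (sum_bot _ n1 n2 (a' k) (fun l => A' l (i + j * nr)%N)).
Qed.

Let n0' := n0bar nr ns.
Let n1' := n1bar nr ns.
Let n2' := n2bar nr ns.

Let V1comb (a : 'I_nt * 'I_(n1' + n0') -> R) (a' : nat -> nat -> R) :
  (forall k l, a (k, l) = a' k l) ->
  lincomb (V1fam pr ps pt tr ts tt (nr := nr) (ns := ns) (nt := nt)) a =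
  vec3 (tens nr ns nt DR BS BT (fun i j k => \sum_(l < n1') a' k l * e10 R nr l (i + j * nr)%N))
       (tens nr (ns - 1) nt BR DS BT (fun i j k => \sum_(l < n1') a' k l * e01 R nr l (i + j * nr)%N))
       (tens nr ns nt BR BS DT (fun i j k => \sum_(l < n0') a' k (n1' + l)%N * e0 R nr l (i + j * nr)%N)).
Proof.
move=> Ha; apply/funext => c; apply/funext => r; apply/funext => s; apply/funext => t.
rewrite /lincomb /V1fam /vec3; case: ifP => _; last case: ifP => _.
- exact: (tens_top _ _ _ _ _ _ _ _ _ _ _ _ _ (E10E R nr ns) Ha).
- exact: (tens_top _ _ _ _ _ _ _ _ _ _ _ _ _ (E01E R nr ns) Ha).
- exact: (tens_bot _ _ _ _ _ _ _ _ _ _ _ _ _ (E0E R nr ns) Ha).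
Qed.

Let E10N l c : (- E10 R nr ns) l c = - e10 R nr l c.
Proof. by rewrite mxE E10E. Qed.

Let V2comb (a : 'I_nt * 'I_(n2' + n1') -> R) (a' : nat -> nat -> R) :
  (forall k l, a (k, l) = a' k l) ->
  lincomb (V2fam pr ps pt tr ts tt (nr := nr) (ns := ns) (nt := nt)) a =
  vec3 (tens nr (ns - 1) nt BR DS DT (fun i j k => \sum_(l < n1') a' k (n2' + l)%N * e01 R nr l (i + j * nr)%N))
       (tens nr ns nt DR BS DT (fun i j k => \sum_(l < n1') a' k (n2' + l)%N * (- e10 R nr l (i + j * nr)%N)))
       (tens nr (ns - 1) nt DR DS BT (fun i j k => \sum_(l < n2') a' k l * e2 R nr l (i + j * nr)%N)).
Proof.
move=> Ha; apply/funext => c; apply/funext => r; apply/funext => s; apply/funext => t.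
rewrite /lincomb /V2fam /vec3; case: ifP => _; last case: ifP => _.
- exact: (tens_bot _ _ _ _ _ _ _ _ _ _ _ _ _ (E01E R nr ns) Ha).
- exact: (tens_bot _ _ _ _ _ _ _ (fun l c => - e10 R nr l c) _ _ _ _ _ E10N Ha).
- exact: (tens_top _ _ _ _ _ _ _ _ _ _ _ _ _ (E2E R nr ns) Ha).
Qed.

Let inV1P (F : field R 3) : inV1 Lr Ls Lt pr ps pt nr ns nt tr ts tt F <->
  exists X Z W, [/\ polar1 R nr X Z, polar0 R nr W &
    eqbox Lr Ls Lt F (vec3 (tens nr ns nt DR BS BT X) (tens nr (ns - 1) nt BR DS BT Z)
      (tens nr ns nt BR BS DT W))].
Proof.
split=> [[a Fa]|[X [Z [W [P1 P0 FC]]]]].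
  have [a' Ha] := extend_coefs _ _ _ a.
  exists (fun i j k => \sum_(l < n1') a' k l * e10 R nr l (i + j * nr)%N).
  exists (fun i j k => \sum_(l < n1') a' k l * e01 R nr l (i + j * nr)%N).
  exists (fun i j k => \sum_(l < n0') a' k (n1' + l)%N * e0 R nr l (i + j * nr)%N).
  split; last by move=> c r s t B; rewrite Fa // (V1comb _ _ Ha).
    exists (fun k => a' k 0%N), (fun k => a' k 1%N) => i k ir.
    have [h0 h1] := sum_e10_edge R nr ns nr0 ns3 (a' k) i ir.
    by split => //; apply: sum_e01_edge.
  exists (fun k => (a' k (n1' + 0) + a' k (n1' + 1) + a' k (n1' + 2)) / 3)%N.
  exists (fun k => a' k (n1' + 1)%N - a' k (n1' + 0)%N), (fun k => a' k (n1' + 2)%N - a' k (n1' + 0)%N) => i k ir.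
  exact: (sum_e0_edge _ _ _ _ _ (fun l => a' k (n1' + l)%N)).
have [b1 [HX HZ]] := polar1_coef _ _ ns nr0 ns3 X Z P1.
have [b0 HW] := polar0_coef _ _ ns nr0 ns3 W P0.
pose a' k l := if (l < n1')%N then b1 k l else b0 k (l - n1')%N.
exists (fun kl : 'I_nt * 'I_(n1' + n0') => a' kl.1 kl.2) => c r s t B.
rewrite FC // (V1comb _ a') // /vec3; case: ifP => _; last case: ifP => _; apply: eq_tens => i j k ir js _.
- by rewrite -HX //; apply: eq_bigr => l _; rewrite /a' ltn_ord.
- by rewrite -HZ //; apply: eq_bigr => l _; rewrite /a' ltn_ord.
- by rewrite -HW //; apply: eq_bigr => l _; rewrite /a' ltnNge leq_addr addKn.
Qed.

(** Writing the sign of [- E10] in front of [X] lets the same relation [polar1] govern this space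
    and the previous one. *)
Let inV2P (F : field R 3) : inV2 Lr Ls Lt pr ps pt nr ns nt tr ts tt F <->
  exists X Z Y, [/\ polar1 R nr X Z, polar2 R nr Y &
    eqbox Lr Ls Lt F (vec3 (tens nr (ns - 1) nt BR DS DT Z)
      (tens nr ns nt DR BS DT (fun i j k => - X i j k))
      (tens nr (ns - 1) nt DR DS BT Y))].
Proof.
split=> [[a Fa]|[X [Z [Y [P1 P2 FC]]]]].
  have [a' Ha] := extend_coefs _ _ _ a.
  exists (fun i j k => \sum_(l < n1') a' k (n2' + l)%N * e10 R nr l (i + j * nr)%N).
  exists (fun i j k => \sum_(l < n1') a' k (n2' + l)%N * e01 R nr l (i + j * nr)%N).
  exists (fun i j k => \sum_(l < n2') a' k l * e2 R nr l (i + j * nr)%N).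
  split.
  - exists (fun k => a' k (n2' + 0)%N), (fun k => a' k (n2' + 1)%N) => i k ir.
    have [h0 h1] := sum_e10_edge R nr ns nr0 ns3 (fun l => a' k (n2' + l)%N) i ir.
    by split => //; apply: (sum_e01_edge _ _ _ _ _ (fun l => a' k (n2' + l)%N)).
  - by move=> i k ir; rewrite sum_e2 //; lia.
  - move=> c r s t B; rewrite Fa // (V2comb _ _ Ha) /vec3.
    case: ifP => _ //; case: ifP => _ //; apply: eq_tens => i j k *.
    by rewrite -sumrN; apply: eq_bigr => l _; rewrite mulrN.
have [b1 [HX HZ]] := polar1_coef _ _ ns nr0 ns3 X Z P1.
have [b0 HY] := polar2_coef _ _ ns nr0 ns3 Y P2.
pose a' k l := if (l < n2')%N then b0 k l else b1 k (l - n2')%N.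
exists (fun kl : 'I_nt * 'I_(n2' + n1') => a' kl.1 kl.2) => c r s t B.
rewrite FC // (V2comb _ a') // /vec3; case: ifP => _; last case: ifP => _; apply: eq_tens => i j k ir js _.
- by rewrite -HZ //; apply: eq_bigr => l _; rewrite /a' ltnNge leq_addr addKn.
- rewrite -HX // -sumrN; apply: eq_bigr => l _; by rewrite /a' ltnNge leq_addr addKn mulrN.
- by rewrite -HY //; apply: eq_bigr => l _; rewrite /a' ltn_ord.
Qed.

(** * Partial derivatives of tensor-product splines *)

Section Derivatives.
Variables (F : R -> R -> R -> R) (C : coefs) (r s t : R).
Hypothesis rst : box r s t.

Let near_itv (x L : R) : 0 < x < L -> \forall y \near x, 0 < y < L.
Proof.
move=> /andP[x0 xL]; have h0 := lt_nbhsr x0; have hL := lt_nbhsl xL.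
near=> y; apply/andP; split; near: y; [exact: h0 | exact: hL].
Unshelve. all: by end_near.
Qed.

Lemma tens_derive_r b c g h x : 0 < x < Lr ->
  is_derive x 1 (fun y => tens nr b c BR g h C y s t)
    (tens nr b c DR g h (diff_r nr C) x s t).
Proof.
move=> xL; rewrite tens_r.
pose w i := \sum_(j < b) \sum_(k < c) C i j k * (g j s * h k t).
have -> : (fun y => tens nr b c BR g h C y s t) = (fun y => \sum_(i < nr) w i * BR i y).
  by apply/funext => y; rewrite tens_r.
have -> : \sum_(i < nr) (\sum_(j < b) \sum_(k < c) diff_r nr C i j k * (g j s * h k t)) * DR i x
   = \sum_(i < nr) (w (i.+1 %% nr)%N - w i) * DR i x.
  apply: eq_bigr => i _; congr (_ * _); rewrite /w -sumrB; apply: eq_bigr => j _.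
  by rewrite -sumrB; apply: eq_bigr => k _; rewrite -mulrBl.
rewrite -(sum_cyclic_diff _ nr w (fun i => DR i x)).
apply: (is_derive_bigsum _ nr (fun i y => w i * BR i y)
  (fun i => w i * ((if i is i'.+1 then DR i' x else DR nr.-1 x) - DR i x))) => i ir.
by apply: is_derive_scale; apply: (perBs_derive _ _ _ _ _ Lr0 pr2 knots_r).
Qed.

Lemma tens_derive_s a c f h x : 0 < x < Ls ->
  is_derive x 1 (fun y => tens a ns c f BS h C r y t)
    (tens a (ns - 1) c f DS h (diff_s C) r x t).
Proof.
move=> xL; rewrite tens_s.
pose w j := \sum_(i < a) \sum_(k < c) C i j k * (f i r * h k t).
have -> : (fun y => tens a ns c f BS h C r y t) = (fun y => \sum_(j < ns) w j * BS j y).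
  by apply/funext => y; rewrite tens_s.
have -> : \sum_(j < ns - 1) (\sum_(i < a) \sum_(k < c) diff_s C i j k * (f i r * h k t)) * DS j x
   = \sum_(j < ns - 1) (w j.+1 - w j) * DS j x.
  apply: eq_bigr => j _; congr (_ * _); rewrite /w -sumrB; apply: eq_bigr => i _.
  by rewrite -sumrB; apply: eq_bigr => k _; rewrite -mulrBl.
rewrite -(sum_diff _ ns w (fun i => DS i x)).
apply: (is_derive_bigsum _ ns (fun i y => w i * BS i y)
  (fun j => w j * ((if j is j'.+1 then DS j' x else 0) -
     (if (j < ns - 1)%N then DS j x else 0)))) => i ir.
by apply: is_derive_scale; apply: (opBs_derive _ _ _ _ _ Ls0 ps2 knots_s).
Qed.

Lemma tens_derive_t a b f g x : 0 < x < Lt ->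
  is_derive x 1 (fun y => tens a b nt f g BT C r s y)
    (tens a b nt f g DT (diff_t nt C) r s x).
Proof.
move=> xL; rewrite tens_t.
pose w k := \sum_(i < a) \sum_(j < b) C i j k * (f i r * g j s).
have -> : (fun y => tens a b nt f g BT C r s y) = (fun y => \sum_(k < nt) w k * BT k y).
  by apply/funext => y; rewrite tens_t.
have -> : \sum_(k < nt) (\sum_(i < a) \sum_(j < b) diff_t nt C i j k * (f i r * g j s)) * DT k x
   = \sum_(k < nt) (w (k.+1 %% nt)%N - w k) * DT k x.
  apply: eq_bigr => k _; congr (_ * _); rewrite /w -sumrB; apply: eq_bigr => i _.
  by rewrite -sumrB; apply: eq_bigr => j _; rewrite -mulrBl.
rewrite -(sum_cyclic_diff _ nt w (fun i => DT i x)).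
apply: (is_derive_bigsum _ nt (fun i y => w i * BT i y)
  (fun i => w i * ((if i is i'.+1 then DT i' x else DT nt.-1 x) - DT i x))) => i ir.
by apply: is_derive_scale; apply: (perBs_derive _ _ _ _ _ Lt0 pt2 knots_t).
Qed.

(** Agreement on the open box is agreement near the point, which determines the derivative of
    [F]. *)
Lemma dr_tens b c g h :
  (forall r s t, box r s t -> F r s t = tens nr b c BR g h C r s t) ->
  dr F r s t = tens nr b c DR g h (diff_r nr C) r s t.
Proof.
move=> FC; have [hr hs ht] := rst; rewrite /dr derive1E.
rewrite -(@derive_val _ _ _ _ _ _ _ (tens_derive_r b c g h r hr)).
by apply: near_eq_derive; apply: filterS (near_itv _ _ hr) => y hy; apply: FC.
Qed.

Lemma ds_tens a c f h :
  (forall r s t, box r s t -> F r s t = tens a ns c f BS h C r s t) ->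
  ds F r s t = tens a (ns - 1) c f DS h (diff_s C) r s t.
Proof.
move=> FC; have [hr hs ht] := rst; rewrite /ds derive1E.
rewrite -(@derive_val _ _ _ _ _ _ _ (tens_derive_s a c f h s hs)).
by apply: near_eq_derive; apply: filterS (near_itv _ _ hs) => y hy; apply: FC.
Qed.

Lemma dt_tens a b f g :
  (forall r s t, box r s t -> F r s t = tens a b nt f g BT C r s t) ->
  dt F r s t = tens a b nt f g DT (diff_t nt C) r s t.
Proof.
move=> FC; have [hr hs ht] := rst; rewrite /dt derive1E.
rewrite -(@derive_val _ _ _ _ _ _ _ (tens_derive_t a b f g t ht)).
by apply: near_eq_derive; apply: filterS (near_itv _ _ ht) => y hy; apply: FC.
Qed.

End Derivatives.

(* All splines in [s] but the first vanish at the polar edge, so a spline without first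
   component is determined by its [s]-derivative. *)
Let tens_edge a c f h (X : coefs) r t :
  (forall i k, (i < a)%N -> X i 0%N k = 0) ->
  (forall s, 0 < s < Ls -> tens a (ns - 1) c f DS h (diff_s X) r s t = 0) ->
  forall s, 0 < s < Ls -> tens a ns c f BS h X r s t = 0.
Proof.
move=> X0 dX s sL.
pose w j := \sum_(i < a) \sum_(k < c) X i j k * (f i r * h k t).
(* Without the first spline the sum is continuous at 0 as well, which the mean value argument on
   [[0, s]] requires. *)
have GE : (fun y => tens a ns c f BS h X r y t) =
    (fun y => \sum_(j < ns - 1) w j.+1 * BS j.+1 y).
  apply/funext => y; rewrite tens_s -/w; have [n nn] : exists n, ns = n.+1 by exists ns.-1; lia.
  rewrite nn big_ord_recl subn1 /= big1 ?mul0r ?add0r // => i _.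
  by rewrite big1 // => k _; rewrite X0 ?mul0r.
have G0 : tens a ns c f BS h X r 0 t = 0.
  have /(congr1 (fun G => G 0)) /= -> := GE; rewrite big1 // => j _.
  by rewrite (opBs_at0 _ _ _ _ _ Ls0 ps2 knots_s) ?mulr0 //; have := ltn_ord j; lia.
have /andP[s0 s1] := sL.
have := @increment_cst_derive _ (fun y => tens a ns c f BS h X r y t) 0 s 0 s0.
rewrite mul0r G0 subr0; apply => x /andP[x0 xs].
  have xL : 0 < x < Ls by rewrite x0 (lt_trans xs).
  by rewrite -(dX x xL); apply: tens_derive_s.
rewrite GE; apply: (continuous_bigsum _ _ (fun j y => w j.+1 * BS j.+1 y)) => j jn.
apply: continuousM; first exact: cst_continuous.
apply: (opBs_continuous _ _ _ _ _ Ls0 ps2 knots_s); first by lia.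
by rewrite x0 (le_lt_trans xs).
Qed.

Let mid (L : R) : 0 < L -> 0 < L / 2 < L.
Proof. by move=> L0; apply/andP; split; lra. Qed.

Let box_mid : box (Lr / 2) (Ls / 2) (Lt / 2).
Proof. by split; apply: mid. Qed.

Let sumBR r : 0 < r < Lr -> \sum_(i < nr) BR i r = 1.
Proof. exact: perBs_sum1. Qed.
Let sumBS s : 0 < s < Ls -> \sum_(j < ns) BS j s = 1.
Proof. exact: opBs_sum1. Qed.
Let sumBT t : 0 < t < Lt -> \sum_(k < nt) BT k t = 1.
Proof. exact: perBs_sum1. Qed.

Let dt0 r s t : dt (fun _ _ _ => 0 : R) r s t = 0.
Proof. by rewrite /dt derive1_cst. Qed.
Let dr0 r s t : dr (fun _ _ _ => 0 : R) r s t = 0.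
Proof. by rewrite /dr derive1_cst. Qed.

(** * The four cohomology spaces *)

Lemma spline_H0 : dimH0 Lr Ls Lt pr ps pt nr ns nt tr ts tt 1.
Proof.
exists (fun _ _ _ _ _ => 1); split.
- move=> _; split.
    apply/inV0P; exists (fun _ _ _ => 1).
      by exists (fun=> 1), (fun=> 0), (fun=> 0) => i k _; split; ring.
    move=> r s t [hr hs ht]; rewrite (tens_sum1 _ _ _ _ _ _ _ (fun=> 1)) ?sumBR ?sumBS //.
    by rewrite -[LHS](sumBT t ht); apply: eq_bigr => k _; rewrite mul1r.
  by apply/eqbox3_zero => r s t B; rewrite /dr /ds /dt !derive1_cst.
- move=> a H i; rewrite (ord1 i); have := H ord0 _ _ _ box_mid.
  by rewrite /lincomb big_ord1 mulr1.
- move=> f [/inV0P[C PC FC] /eqbox3_zero df].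
  exists (fun=> tens nr ns nt BR BS BT C (Lr / 2) (Ls / 2) (Lt / 2)).
  move=> c r s t B; rewrite (ord1 c) /subf /lincomb big_ord1 mulr1 FC //.
  have [hr hs ht] := B; have [mr ms mt] := box_mid.
  have Dr r' s' t' : box r' s' t' -> tens nr ns nt DR BS BT (diff_r nr C) r' s' t' = 0.
    by move=> B'; have [<- _ _] := df _ _ _ B'; rewrite -(dr_tens (f ord0)).
  have Ds r' s' t' : box r' s' t' -> tens nr (ns - 1) nt BR DS BT (diff_s C) r' s' t' = 0.
    by move=> B'; have [_ <- _] := df _ _ _ B'; rewrite -(ds_tens (f ord0)).
  have Dt r' s' t' : box r' s' t' -> tens nr ns nt BR BS DT (diff_t nt C) r' s' t' = 0.
    by move=> B'; have [_ _ <-] := df _ _ _ B'; rewrite -(dt_tens (f ord0)).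
  apply/eqP; rewrite subr_eq0; apply/eqP.
  (* The point moves to the centre one coordinate at a time, never leaving the box. *)
  transitivity (tens nr ns nt BR BS BT C (Lr / 2) s t).
    apply: (@eq_zero_derive _ (fun x => tens nr ns nt BR BS BT C x s t) 0 Lr) => // x xL.
    by rewrite -(Dr x s t) //; apply: tens_derive_r.
  transitivity (tens nr ns nt BR BS BT C (Lr / 2) (Ls / 2) t).
    apply: (@eq_zero_derive _ (fun x => tens nr ns nt BR BS BT C (Lr / 2) x t) 0 Ls) => // x xL.
    by rewrite -(Ds (Lr / 2) x t) //; apply: tens_derive_s.
  apply: (@eq_zero_derive _ (fun x => tens nr ns nt BR BS BT C (Lr / 2) (Ls / 2) x) 0 Lt) => // x xL.
  by rewrite -(Dt (Lr / 2) (Ls / 2) x) //; apply: tens_derive_t.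
Qed.

(** The partial sums are 0 on ring 0 and equal ring 0 of [Z] on ring 1, so they inherit its slopes,
    with edge value 0. *)
Let polar0_int_s X Z : polar1 R nr X Z -> polar0 R nr (int_s Z).
Proof.
move=> [al [be H]]; exists (fun=> 0), al, be => i k ir.
by have [_ _ h] := H i k ir; rewrite /int_s big_ord0 big_ord1 h add0r.
Qed.

Let polar1_diff X Z i k : polar1 R nr X Z -> (i < nr)%N ->
  X i 0%N k - diff_r nr (int_s Z) i 0%N k = 0.
Proof.
move=> [al [be H]] ir; have [-> _ _] := H i k ir.
by rewrite /diff_r /int_s !big_ord0 !subrr.
Qed.

Let polar1_int_s Y : polar2 R nr Y ->
  polar1 R nr (fun i j k => - int_s Y i j k) (fun _ _ _ => 0).
Proof.
move=> HY; exists (fun=> 0), (fun=> 0) => i k ir.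
by rewrite /int_s big_ord0 big_ord1 HY //; split; ring.
Qed.

Lemma spline_H3 : dimH3 Lr Ls Lt pr ps pt nr ns nt tr ts tt 0.
Proof.
exists (fun _ _ _ _ _ => 0); split=> [[]||F] //; first by move=> a _ [].
move=> /inV3P[Y HY FY]; exists (fun=> 0).
(* The sign built into the second component of V_2 turns this back into [int_s Y]. *)
pose X i j k := - int_s Y i j k.
exists (vec3 (fun _ _ _ => 0) (tens nr ns nt DR BS DT (fun i j k => - X i j k)) (fun _ _ _ => 0)).
split.
  apply/inV2P; exists X, (fun _ _ _ => 0), (fun _ _ _ => 0).
  split; [exact: polar1_int_s | by [] |].
  apply/eqbox3 => r s t B.
  by have [-> -> ->] := cmp3_vec3 R (fun _ _ _ => 0)
    (tens nr ns nt DR BS DT (fun i j k => - X i j k)) (fun _ _ _ => 0); rewrite !tens0.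
move=> c r s t B; rewrite (ord1 c) /subf /lincomb big_ord0 subr0 FY // /div.
have [-> -> ->] := cmp3_vec3 R (fun _ _ _ => 0)
    (tens nr ns nt DR BS DT (fun i j k => - X i j k)) (fun _ _ _ => 0).
rewrite dr0 dt0 addr0 add0r (ds_tens _ (fun i j k => - X i j k) _ _ _ B nr nt DR DT) //.
by apply: eq_tens => i j k *; rewrite -(diff_int_s R Y) /diff_s /X !opprK.
Qed.

Lemma spline_H2 : dimH2 Lr Ls Lt pr ps pt nr ns nt tr ts tt 0.
Proof.
exists (fun _ _ _ _ _ => 0); split=> [[]||F] //; first by move=> a _ [].
move=> [/inV2P[X [Z [Y [P1 P2 /eqbox3 FE]]]] dF]; exists (fun=> 0).
(* The potential is sought with zero [s]-component, as [(a, 0, C)]. The first and third components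
   of its curl are then [s]-derivatives and dictate [C] and [a]; [X'] is the error left in the
   second. *)
pose a i j k := - int_s Y i j k.
pose C := int_s Z.
pose X' i j k := (X i j k + diff_t nt a i j k) - diff_r nr C i j k.
have X'0 r s t : box r s t -> tens nr ns nt DR BS DT X' r s t = 0.
  move=> [hr hs ht]; apply: tens_edge s hs => [i k ir|s hs].
    rewrite /X' addrAC polar1_diff // add0r /diff_t /a /int_s !big_ord0; ring.
  have B : box r s t by [].
  have := dF ord0 r s t B; rewrite /div.
  rewrite (dr_tens _ Z _ _ _ B (ns - 1)%N nt DS DT); last by move=> ? ? ? /FE[].
  rewrite (ds_tens _ (fun i j k => - X i j k) _ _ _ B nr nt DR DT); last by move=> ? ? ? /FE[].
  rewrite (dt_tens _ Y _ _ _ B nr (ns - 1)%N DR DS); last by move=> ? ? ? /FE[].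
  (* On coefficients the divergence is minus the [s]-difference of [X'], because [Z] and [Y] are the
     [s]-differences of [C] and [- a]. *)
  rewrite -!tensD /zerof => /eqP; rewrite -oppr_eq0 -tensN => /eqP <-.
  apply: eq_tens => i j k *.
  have hZ i' k' : Z i' j k' = C i' j.+1 k' - C i' j k' by rewrite -(diff_int_s R Z).
  have hY i' k' : Y i' j k' = - (a i' j.+1 k' - a i' j k').
    by rewrite -(diff_int_s R Y) /diff_s /a; ring.
  by rewrite /X' /diff_s /diff_r /diff_t !hZ !hY; ring.
exists (vec3 (tens nr ns nt DR BS BT a) (fun _ _ _ => 0) (tens nr ns nt BR BS DT C)).
have [c0 c1 c2] := cmp3_vec3 R (tens nr ns nt DR BS BT a) (fun _ _ _ => 0) (tens nr ns nt BR BS DT C).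
split.
  apply/inV1P; exists a, (fun _ _ _ => 0), C; split.
  - exact: polar1_int_s.
  - exact: polar0_int_s P1.
  - by apply/eqbox3 => r s t B; rewrite c0 c1 c2 tens0.
apply/eqbox3 => r s t B.
rewrite /cmp3 /subf /lincomb !big_ord0 !subr0 -!/(cmp3 _ _) c0 c1 c2.
have [-> -> ->] := FE _ _ _ B; split.
- rewrite dt0 subr0 (ds_tens _ C _ _ _ B nr nt BR DT) //.
  by apply: eq_tens => i j k *; rewrite diff_int_s.
- rewrite (dt_tens _ a _ _ _ B nr ns DR BS) // (dr_tens _ C _ _ _ B ns nt BS DT) //.
  rewrite -tensB -[LHS]addr0 -(X'0 _ _ _ B) -tensD; apply: eq_tens => i j k *.
  by rewrite /X'; ring.
- rewrite dr0 sub0r (ds_tens _ a _ _ _ B nr nt DR BT) // -tensN.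
  by apply: eq_tens => i j k *; rewrite -(diff_int_s R Y) /diff_s /a; ring.
Qed.

Lemma spline_H1 : dimH1 Lr Ls Lt pr ps pt nr ns nt tr ts tt 1.
Proof.
have [w w0 w1] := perDs_sum1 _ _ _ _ _ Lt0 pt2 knots_t.
pose e : field R 3 := vec3 (fun _ _ _ => 0) (fun _ _ _ => 0) (fun _ _ _ => 1).
have [e0 e1 e2] := cmp3_vec3 R (fun _ _ _ => 0) (fun _ _ _ => 0) (fun _ _ _ => 1).
exists (fun _ => e); split.
- move=> _; split.
    apply/inV1P; exists (fun _ _ _ => 0), (fun _ _ _ => 0), (fun _ _ k => w k); split.
    + by exists (fun=> 0), (fun=> 0) => i k _; split; ring.
    + by exists w, (fun=> 0), (fun=> 0) => i k _; split; ring.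
    + apply/eqbox3 => r s t [hr hs ht]; rewrite e0 e1 e2 !tens0.
      by rewrite tens_sum1 ?sumBR ?sumBS ?w1.
  apply/eqbox3_zero => r s t B; rewrite e0 e1 e2 /dr /ds /dt !derive1_cst.
  by split; ring.
- move=> a [h [/inV0P[C PC hC] /eqbox3 ae]] i; rewrite (ord1 i).
  have [mr ms mt] := box_mid.
  pose G := tens nr ns nt BR BS BT C (Lr / 2) (Ls / 2).
  have G' x : 0 < x < Lt -> is_derive x 1 G (a ord0).
    move=> hx; have B : box (Lr / 2) (Ls / 2) x by [].
    have [_ _] := ae _ _ _ B; rewrite /cmp3 /lincomb big_ord1 -/(cmp3 _ _) e2 mulr1 => ->.
    by rewrite (dt_tens _ C _ _ _ B nr ns BR BS) //; apply: tens_derive_t.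
  pose wt k := \sum_(i < nr) \sum_(j < ns) C i j k * (BR i (Lr / 2) * BS j (Ls / 2)).
  have GE : G = (fun y => \sum_(k < nt) wt k * BT k y).
    by apply/funext => y; rewrite /G tens_t.
  have := @increment_cst_derive _ G 0 Lt (a ord0) Lt0 G'; rewrite subr0.
  have -> : G Lt - G 0 = 0.
    apply/eqP; rewrite subr_eq0 GE; apply/eqP; apply: eq_bigr => k _.
    by rewrite /perBs (perB_ends _ _ _ _ _ Lt0 pt2 knots_t).
  move=> E; have /esym/eqP : 0 = a ord0 * Lt.
    apply: E => x _; rewrite GE.
    apply: (continuous_bigsum _ _ (fun k y => wt k * BT k y)) => k kn.
    apply: continuousM; first exact: cst_continuous.
    exact: (perB_continuous _ _ _ _ _ Lt0 pt2 knots_t).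
  by rewrite mulf_eq0 (gt_eqF Lt0) orbF => /eqP.
- move=> F [/inV1P[X [Z [W [P1 P0 /eqbox3 FE]]]] /eqbox3_zero dF].
  (* [C] matches the [s]-component; [X'] and [W'] are what its gradient leaves of the [r]- and
     [t]-components. *)
  pose C := int_s Z.
  pose X' i j k := X i j k - diff_r nr C i j k.
  pose W' i j k := W i j k - diff_t nt C i j k.
  have F0 r s t : box r s t -> cmp3 F 0 r s t = tens nr ns nt DR BS BT X r s t by move=> /FE[].
  have F1 r s t : box r s t -> cmp3 F 1 r s t = tens nr (ns - 1) nt BR DS BT Z r s t by move=> /FE[].
  have F2 r s t : box r s t -> cmp3 F 2 r s t = tens nr ns nt BR BS DT W r s t by move=> /FE[].
  have X'0 r s t : box r s t -> tens nr ns nt DR BS BT X' r s t = 0.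
    move=> [hr hs ht]; apply: tens_edge s hs => [i k ir|s hs]; first exact: polar1_diff.
    have B : box r s t by [].
    have [_ _] := dF r s t B.
    rewrite (dr_tens _ _ _ _ _ B _ _ _ _ F1) (ds_tens _ _ _ _ _ B _ _ _ _ F0).
    rewrite -tensB => /eqP; rewrite -oppr_eq0 -tensN => /eqP <-.
    apply: eq_tens => i j k *.
    have hZ i' k' : Z i' j k' = C i' j.+1 k' - C i' j k' by rewrite -(diff_int_s R Z).
    by rewrite /X' /diff_s /diff_r !hZ; ring.
  have sW r s t : box r s t -> tens nr (ns - 1) nt BR DS DT (diff_s W') r s t = 0.
    move=> B; have [] := dF r s t B.
    rewrite (ds_tens _ _ _ _ _ B _ _ _ _ F2) (dt_tens _ _ _ _ _ B _ _ _ _ F1) -tensB => <- _ _.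
    apply: eq_tens => i j k *.
    have hZ i' k' : Z i' j k' = C i' j.+1 k' - C i' j k' by rewrite -(diff_int_s R Z).
    by rewrite /W' /diff_s /diff_t !hZ; ring.
  have rW r s t : box r s t -> tens nr ns nt DR BS DT (diff_r nr W') r s t = 0.
    move=> B; have [_] := dF r s t B.
    rewrite (dr_tens _ _ _ _ _ B _ _ _ _ F2) (dt_tens _ _ _ _ _ B _ _ _ _ F0) -tensB => E _.
    (* Only the function with coefficients [X'] is known to vanish, so its [t]-differences are read
       as the derivative of the zero function. *)
    have X't : tens nr ns nt DR BS DT (diff_t nt X') r s t = 0.
      rewrite -(dt0 r s t); apply/esym/dt_tens => // r' s' t' B'; by rewrite X'0.
    rewrite -X't -[LHS]addr0 -E -tensD; apply: eq_tens => i j k *.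
    by rewrite /W' /X' /diff_t /diff_r; ring.
  have [mr ms mt] := box_mid.
  (* The remainder does not depend on [r] and [s], so freezing both at the centre gives its
     coefficients in [t]. *)
  pose psi k := \sum_(i < nr) \sum_(j < ns) W' i j k * (BR i (Lr / 2) * BS j (Ls / 2)).
  have psiE r s t : box r s t -> tens nr ns nt BR BS DT W' r s t = \sum_(k < nt) psi k * DT k t.
    move=> [hr hs ht]; rewrite -tens_t.
    transitivity (tens nr ns nt BR BS DT W' (Lr / 2) s t).
      apply: (@eq_zero_derive _ (fun x => tens nr ns nt BR BS DT W' x s t) 0 Lr) => // x xL.
      by rewrite -(rW x s t) //; apply: tens_derive_r.
    apply: (@eq_zero_derive _ (fun x => tens nr ns nt BR BS DT W' (Lr / 2) x t) 0 Ls) => // x xL.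
    by rewrite -(sW (Lr / 2) x t) //; apply: tens_derive_s.
  (* This value makes the sum of [psi k - a * w k] zero, the solvability condition of
     [cyclic_int]. *)
  pose a := (\sum_(k < nt) psi k) / \sum_(k < nt) w k.
  have [|kap kapE] := cyclic_int _ nt (fun k => psi k - a * w k).
    by rewrite sumrB -mulr_sumr /a divfK ?subrr.
  exists (fun=> a).
  (* A correction depending on [k] alone only shifts the edge value [q] in [polar0] and leaves the
     [r]- and [s]-differences unchanged. *)
  pose H i j k := C i j k + kap k.
  exists (fun=> tens nr ns nt BR BS BT H); split.
    apply/inV0P; exists H => //; have [q [al [be HC]]] := polar0_int_s _ _ P1.
    exists (fun k => q k + kap k), al, be => i k ir; have [h0 h1] := HC i k ir.
    by rewrite /H /C h0 h1; split; ring.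
  apply/eqbox3 => r s t B; rewrite /cmp3 /subf /lincomb !big_ord1 -!/(cmp3 _ _) e0 e1 e2 !mulr0 !subr0 mulr1.
  rewrite F0 // F1 // F2 //; have [hr hs ht] := B; split.
  + rewrite (dr_tens _ H _ _ _ B ns nt BS BT) // -[RHS]addr0 -(X'0 _ _ _ B) -tensD.
    by apply: eq_tens => i j k *; rewrite /X' /H /diff_r; ring.
  + rewrite (ds_tens _ H _ _ _ B nr nt BR BT) //.
    by apply: eq_tens => i j k *; rewrite -(diff_int_s R Z) /H /C /diff_s; ring.
  + rewrite (dt_tens _ H _ _ _ B nr ns BR BS) //.
    rewrite (eq_tens _ _ _ _ _ _ _ (diff_t nt H) (fun i j k => W i j k - W' i j k + (psi k - a * w k))); last first.
      by move=> i j k _ _ kn; rewrite -kapE // /H /W' /diff_t; ring.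
    rewrite tensD tensB psiE // tens_sum1 ?sumBR ?sumBS //.
    under [X in _ = _ + X]eq_bigr do rewrite mulrBl -mulrA.
    by rewrite sumrB -mulr_sumr w1 //; ring.
Qed.

End Complex.

Local Close Scope classical_set_scope.

Theorem theorem4p1 (R : realType) (Lr Ls Lt : R)
    (pr ps pt nr ns nt : nat) (tr ts tt : int -> R) :
  0 < Lr -> 0 < Ls -> 0 < Lt ->
  (2 <= pr)%N -> (2 <= ps)%N -> (2 <= pt)%N ->
  (3 <= nr)%N ->
  periodic_C1_knots tr nr pr Lr ->
  open_C1_knots ts ns ps Ls ->
  periodic_C1_knots tt nt pt Lt ->
  [/\ dimH0 Lr Ls Lt pr ps pt nr ns nt tr ts tt 1,
      dimH1 Lr Ls Lt pr ps pt nr ns nt tr ts tt 1,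
      dimH2 Lr Ls Lt pr ps pt nr ns nt tr ts tt 0 &
      dimH3 Lr Ls Lt pr ps pt nr ns nt tr ts tt 0].
Proof.
move=> Lr0 Ls0 Lt0 pr2 ps2 pt2 _ kr ks kt; split.
- exact: spline_H0.
- exact: spline_H1.
- exact: spline_H2.
- exact: spline_H3.
Qed.
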